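(* Let $\alpha_0,\alpha_1>0$, $0<d<n$, and equip the Stiefel manifold $\mathrm{St}_{\mathbb K,d,n}$ with the Riemannian metric induced by the operator $\mathsf g(Y)\omega=\alpha_0\omega+(\alpha_1-\alpha_0)YY^{\mathfrak t}\omega$ on $\mathcal E:=\mathbb K^{n\times d}$. The horizontal space $\mathcal H_Y$ at $Y\in\mathrm{St}_{\mathbb K,d,n}$ of the quotient $\mathrm{St}_{\mathbb K,d,n}\to\mathrm{St}_{\mathbb K,d,n}/\mathrm U_{\mathbb K,\hat d}$ consists of the matrices $\omega\in\mathcal E$ such that $$(Y^{\mathfrak t}\omega)_{\mathrm{symf}}=0,$$ or equivalently, such that $Y^{\mathfrak t}\omega$ is $\mathfrak t$-antisymmetric with its first $q$ diagonal blocks $((Y^{\mathfrak t}\omega)_{\mathrm{symf}})_{[ii]}$, $1\le i\le q$, vanishing. For $\omega\in\mathcal E$, the projection $\Pi_{\mathcal H}$ from $\mathcal E$ to $\mathcal H_Y$ and the Riemannian gradient are given by $$\Pi_{\mathcal H}\omega=\omega-Y(Y^{\mathfrak t}\omega)_{\mathrm{symf}},$$ $$\Pi_{\mathcal H}\mathsf g^{-1}\hat f_Y=\alpha_0^{-1}\hat f_Y+(\alpha_1^{-1}-\alpha_0^{-1})YY^{\mathfrak t}\hat f_Y-\alpha_1^{-1}Y(Y^{\mathfrak t}\hat f_Y)_{\mathrm{symf}}.$$ Let $\Pi_0=I_n-YY^{\mathfrak t}$. For two vector fields on the quotient with horizontal lifts $\xi,\eta$, the horizontal lift of the Levi-Civita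 connection and the Riemannian Hessians are given by $$\Pi_{\mathcal H}\nabla_\xi\eta=\mathrm D_\xi\eta+Y(\xi^{\mathfrak t}\eta)_{\mathrm{symf}}+\frac{\alpha_0-\alpha_1}{\alpha_0}\Pi_0(\xi\eta^{\mathfrak t}+\eta\xi^{\mathfrak t})Y,$$ $$\mathsf{rhess}^{02}_f(\xi,\eta)=\hat f_{YY}(\xi,\eta)-\mathrm{Tr}_{\mathbb R}\Big(\hat f_Y^{\mathfrak t}\Big\{Y(\xi^{\mathfrak t}\eta)_{\mathrm{symf}}+\frac{\alpha_0-\alpha_1}{\alpha_0}\Pi_0(\xi\eta^{\mathfrak t}+\eta\xi^{\mathfrak t})Y\Big\}\Big),$$ $$\mathsf{rhess}^{11}_f\xi=\Pi_{\mathcal H}\mathsf g^{-1}\Big(\hat f_{YY}\xi-\xi(Y^{\mathfrak t}\hat f_Y)_{\mathrm{symf}}-\frac{\alpha_0-\alpha_1}{\alpha_0}(\Pi_0\hat f_YY^{\mathfrak t}+Y\hat f_Y^{\mathfrak t}\Pi_0)\xi\Big).$$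
   Context: $\mathbb K$ is $\mathbb R$ or $\mathbb C$; $\mathfrak t$ is the transpose if $\mathbb K=\mathbb R$ and the Hermitian transpose if $\mathbb K=\mathbb C$. $\mathrm{Tr}_{\mathbb R}$ is the trace if $\mathbb K=\mathbb R$ and the real part of the trace if $\mathbb K=\mathbb C$. Matrix spaces are real inner product spaces with $\langle a,b\rangle=\mathrm{Tr}_{\mathbb R}(ab^{\mathfrak t})$. A square matrix $A$ is $\mathfrak t$-antisymmetric if $A^{\mathfrak t}=-A$. $\mathrm{St}_{\mathbb K,d,n}=\{Y\in\mathbb K^{n\times d}: Y^{\mathfrak t}Y=I_d\}\subset\mathcal E=\mathbb K^{n\times d}$, with Riemannian metric $\langle\omega_1,\mathsf g(Y)\omega_2\rangle$ on tangent vectors. $\mathrm U_{\mathbb K,m}=\{U\in\mathbb K^{m\times m}:U^{\mathfrak t}U=I_m\}$. $\hat d=\{d_1,\dots,d_q\}$ ($q\ge0$) is a sequence of positive integers with $\sum_{i=1}^q d_i\le d$, and $d_{q+1}=d-\sum_{i=1}^qd_i\ge0$. A matrix $A\in\mathbb K^{d\times d}$ is partitioned into $(q+1)\times(q+1)$ blocks $A_{[ij]}\in\mathbb K^{d_i\times d_j}$ (blocks with index $q+1$ are empty when $d_{q+1}=0$). $\mathrm U_{\mathbb K,\hat d}$ is the group of block-diagonal matrices $\mathrm{diag}(U_{[11]},\dots,U_{[qq]},I_{d_{q+1}})$ with $U_{[ii]}\in\mathrm U_{\mathbb K,d_i}$ (equal to $\{I_d\}$ if $q=0$). It acts on $\mathrm{St}_{\mathbb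 K,d,n}$ by right multiplication, by isometries, and the quotient carries the quotient Riemannian metric; horizontal means tangent to $\mathrm{St}_{\mathbb K,d,n}$ and $\mathsf g$-orthogonal to the orbits. $A_{\mathrm{symf}}\in\mathbb K^{d\times d}$ is defined by $(A_{\mathrm{symf}})_{[ij]}=\frac12(A_{[ij]}+A_{[ji]}^{\mathfrak t})$ if $1\le i\ne j\le q+1$ or $i=j=q+1$, and $(A_{\mathrm{symf}})_{[ii]}=A_{[ii]}$ if $1\le i\le q$. $\Pi_{\mathcal H}$ is the projection $\mathcal E\to\mathcal H_Y$ orthogonal for the inner product $\langle\cdot,\mathsf g(Y)\cdot\rangle$. $\mathrm D_\xi$ is the directional derivative of matrix-valued functions on $\mathrm{St}_{\mathbb K,d,n}$; $\nabla$ is the Levi-Civita connection of $\mathrm{St}_{\mathbb K,d,n}$; $\Pi_{\mathcal H}\nabla_\xi\eta$ is the horizontal lift of the Levi-Civita covariant derivative of the quotient. $f$ is a function on the quotient, viewed as a $\mathrm U_{\mathbb K,\hat d}$-invariant function on $\mathrm{St}_{\mathbb K,d,n}$. $\hat f_Y$ is an ambient gradient of $f$: a function $\mathrm{St}_{\mathbb K,d,n}\to\mathcal E$ with $\langle\eta,\hat f_Y\rangle=\mathrm D_\eta f$ for all vector fields $\eta$ on $\mathrm{St}_{\mathbb K,d,n}$ (e.g. the gradient of an extension of $f$ to a neighborhood in $\mathcal E$); $\hat f_{YY}\xi=\mathrm D_\xi\hat f_Y$ and $\hat f_{YY}(\xi,\eta)=\langle\mathrm D_\xi\hat f_Y,\eta\rangle$.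 The (lifted) Riemannian gradient is $\Pi_{\mathcal H}\mathsf g^{-1}\hat f_Y$, and $\mathsf{rhess}^{11}_f\xi=\Pi_{\mathcal H}\nabla_\xi(\Pi_{\mathcal H}\mathsf g^{-1}\hat f_Y)$, $\mathsf{rhess}^{02}_f(\xi,\eta)=\langle\mathsf{rhess}^{11}_f\xi,\mathsf g\eta\rangle$ are the horizontal lift of the Riemannian Hessian operator and the Riemannian Hessian bilinear form. *)

(* Defs.v *)
From HB Require Import structures.
From mathcomp Require Import all_boot all_order all_algebra.
From mathcomp Require Import ring complex.
From mathcomp Require Import boolp classical_sets functions reals topology.
From mathcomp Require Import normedtype landau derive.
Set Implicit Arguments.
Unset Strict Implicit.
Unset Printing Implicit Defensive.
Import Order.TTheory GRing.Theory Num.Theory.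
Import numFieldNormedType.Exports.
Local Open Scope classical_set_scope.
Local Open Scope ring_scope.

(* Used only through the two instances realStarField and complexStarField: it
   lets one construction of the real inner product space K^(m x n) serve both. *)
Record starField (R : realType) := StarField {
  carrier :> fieldType;
  sconj : {rmorphism carrier -> carrier};
  sre : {additive carrier -> R};
  sinj : {rmorphism R -> carrier};
  sre_injM : forall a x, sre (sinj a * x) = a * sre x;
  sconj_inj : forall a, sconj (sinj a) = sinj a;
  sconjK : involutive sconj;
  sre_conj : forall x, sre (sconj x) = sre x;
  sre_norm_ge0 : forall x, 0 <= sre (x * sconj x);
  sre_norm_eq0 : forall x, sre (x * sconj x) = 0 -> x = 0
}.

Section RealField.
Variable R : realType.

Let re_norm_ge0_R (x : R) : 0 <= x * x.
Proof. by rewrite -expr2 sqr_ge0. Qed.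

Let re_norm_eq0_R (x : R) : x * x = 0 -> x = 0.
Proof. by move/eqP; rewrite -expr2 sqrf_eq0 => /eqP. Qed.

Definition realStarField : starField R :=
  @StarField R R idfun idfun idfun (fun _ _ => erefl) (fun _ => erefl)
    (fun _ => erefl) (fun _ => erefl) re_norm_ge0_R re_norm_eq0_R.

End RealField.

Section ComplexField.
Variable R : realType.

Let re_injM_C (a : R) (x : R[i]) :
  complex.Re (real_complex R a * x) = a * complex.Re x.
Proof. by case: x => b c /=; rewrite mul0r subr0. Qed.

Let conj_inj_C (a : R) : conjc (real_complex R a) = real_complex R a.
Proof. by rewrite /= oppr0. Qed.

Let conjK_C (x : R[i]) : conjc (conjc x) = x.
Proof. by case: x => a b /=; rewrite opprK. Qed.

Let re_conj_C (x : R[i]) : complex.Re (conjc x) = complex.Re x.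
Proof. by case: x. Qed.

Let re_norm_ge0_C (x : R[i]) : 0 <= complex.Re (x * conjc x).
Proof. by case: x => a b /=; rewrite mulrN opprK addr_ge0 // -expr2 sqr_ge0. Qed.

Let re_norm_eq0_C (x : R[i]) : complex.Re (x * conjc x) = 0 -> x = 0.
Proof.
case: x => a b /= /eqP.
rewrite mulrN opprK -!expr2 paddr_eq0 ?sqr_ge0 // !sqrf_eq0.
by case/andP => /eqP -> /eqP ->.
Qed.

Definition complexStarField : starField R :=
  @StarField R R[i] (@conjc R) (@complex.Re R) (real_complex R)
    re_injM_C conj_inj_C conjK_C re_conj_C re_norm_ge0_C re_norm_eq0_C.

End ComplexField.

Variant ground := RealGround | ComplexGround.

Definition scal (R : realType) (F : ground) : starField R :=
  match F with
  | RealGround => realStarField R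
  | ComplexGround => complexStarField R
  end.

Section MatrixSpace.
Context {R : realType} (K : starField R).

(* The transpose over R, the Hermitian transpose over R[i] *)
Definition ctr m n (A : 'M[K]_(m, n)) : 'M[K]_(n, m) := map_mx (sconj K) A^T.

Definition inner m n (a b : 'M[K]_(m, n)) : R := sre K (\tr (a *m ctr b)).

(* K^(m x n) as a normed space over R (not over K), with the norm of inner;
   the library's own normed structure on 'M[K]_(m, n) has scalars in K. *)
Definition rmx m n : Type := 'M[K]_(m, n).

HB.instance Definition _ m n := GRing.Zmodule.on (rmx m n).

Definition rscale m n (a : R) (x : rmx m n) : rmx m n :=
  (sinj K a : K) *: (x : 'M[K]_(m, n)).

Let rscaleA m n a b (x : rmx m n) : rscale a (rscale b x) = rscale (a * b) x.
Proof. by rewrite /rscale scalerA rmorphM. Qed.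

Let rscale1 m n : left_id 1 (@rscale m n).
Proof. by move=> x; rewrite /rscale rmorph1 scale1r. Qed.

Let rscaleDr m n : right_distributive (@rscale m n) +%R.
Proof. by move=> a x y; rewrite /rscale scalerDr. Qed.

Let rscaleDl m n (x : rmx m n) : {morph (@rscale m n)^~ x : a b / a + b}.
Proof. by move=> a b; rewrite /rscale rmorphD scalerDl. Qed.

HB.instance Definition _ m n := GRing.Zmodule_isLmodule.Build R (rmx m n)
  (@rscaleA m n) (@rscale1 m n) (@rscaleDr m n) (@rscaleDl m n).

Section Norm.
Variables m n : nat.
Implicit Types (a : R) (x y z : rmx m n).

Lemma ctrD x y : ctr (x + y) = ctr x + ctr y.
Proof. by rewrite /ctr linearD map_mxD. Qed.

Lemma ctrK x : ctr (ctr x) = x.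
Proof. by apply/matrixP => i j; rewrite !mxE sconjK. Qed.

Lemma ctr_scale a x : ctr (a *: x) = (sinj K a : K) *: ctr x.
Proof. by apply/matrixP => i j; rewrite !mxE rmorphM /= sconj_inj. Qed.

Lemma sre_tr_scale p a (A : 'M[K]_p) :
  sre K (\tr ((sinj K a : K) *: A)) = a * sre K (\tr A).
Proof. by rewrite mxtraceZ sre_injM. Qed.

Lemma innerC x y : inner x y = inner y x.
Proof.
rewrite /inner -[in RHS]sre_conj; congr (sre K _).
rewrite /mxtrace rmorph_sum; apply: eq_bigr => i _.
rewrite !mxE rmorph_sum; apply: eq_bigr => j _.
by rewrite !mxE rmorphM /= sconjK mulrC.
Qed.

Lemma innerDl x y z : inner (x + y) z = inner x z + inner y z.
Proof. by rewrite /inner mulmxDl !raddfD. Qed.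

Lemma innerZl a x y : inner (a *: x) y = a * inner x y.
Proof. by rewrite /inner -scalemxAl sre_tr_scale. Qed.

Lemma innerDr x y z : inner z (x + y) = inner z x + inner z y.
Proof. by rewrite innerC innerDl !(innerC z). Qed.

Lemma innerZr a x y : inner y (a *: x) = a * inner y x.
Proof. by rewrite innerC innerZl (innerC y). Qed.

Lemma innerE x : inner x x = \sum_i \sum_j sre K (x i j * sconj K (x i j)).
Proof.
rewrite /inner /mxtrace raddf_sum; apply: eq_bigr => i _.
by rewrite !mxE raddf_sum; apply: eq_bigr => j _; rewrite !mxE.
Qed.

Lemma inner_ge0 x : 0 <= inner x x.
Proof.
by rewrite innerE; do 2![apply: sumr_ge0 => ? _]; exact: sre_norm_ge0.
Qed.

Lemma inner_eq0 x : inner x x = 0 -> x = 0.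
Proof.
rewrite innerE => /eqP; rewrite psumr_eq0; last first.
  by move=> i _; apply: sumr_ge0 => j _; exact: sre_norm_ge0.
move=> /allP h; apply/matrixP => i j; rewrite mxE.
have /= := h i (mem_index_enum _).
rewrite psumr_eq0; last by move=> k _; exact: sre_norm_ge0.
by move=> /allP /(_ j (mem_index_enum _)) /= /eqP /sre_norm_eq0.
Qed.

Lemma cauchy_schwarz x y : inner x y ^+ 2 <= inner x x * inner y y.
Proof.
have [y0|y0] := eqVneq (inner y y) 0.
  have -> : inner x y = 0.
    by rewrite (inner_eq0 y0) -(scale0r (0 : rmx m n)) innerZr mul0r.
  by rewrite expr0n mulr_ge0 // inner_ge0.
have yp : 0 < inner y y by rewrite lt_def y0 inner_ge0.
have := inner_ge0 (inner y y *: x + (- inner x y) *: y).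
rewrite innerDl !innerZl !innerDr !innerZr (innerC y x).
set a := inner x y; set b := inner y y; set c := inner x x => h.
have {h} : 0 <= b * (c * b - a ^+ 2).
  by apply: le_trans h _; rewrite le_eqVlt; apply/orP; left; apply/eqP; ring.
by rewrite pmulr_rge0 // subr_ge0.
Qed.

Definition rmx_norm x : R := Num.sqrt (inner x x).

Let ler_rmx_normD x y : rmx_norm (x + y) <= rmx_norm x + rmx_norm y.
Proof.
rewrite -[leRHS]ger0_norm ?addr_ge0 ?sqrtr_ge0 // -sqrtr_sqr ler_wsqrtr //.
rewrite innerDl !innerDr (innerC y x) sqrrD !sqr_sqrtr ?inner_ge0 //.
rewrite addrA lerD2r -addrA lerD2l -mulr2n lerMn2r /=.
rewrite -sqrtrM ?inner_ge0 // (le_trans (ler_norm _)) // -sqrtr_sqr.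
by rewrite ler_wsqrtr // cauchy_schwarz.
Qed.

Let rmx_normZ a x : rmx_norm (a *: x) = `|a| * rmx_norm x.
Proof.
by rewrite /rmx_norm innerZl innerZr mulrA -expr2 sqrtrM ?sqr_ge0 // sqrtr_sqr.
Qed.

Let rmx_norm0_eq0 x : rmx_norm x = 0 -> x = 0.
Proof.
move=> /eqP; rewrite sqrtr_eq0 => h; apply: inner_eq0.
by apply/eqP; rewrite eq_le h inner_ge0.
Qed.

HB.instance Definition _ := Lmodule_isNormed.Build R (rmx m n)
  ler_rmx_normD rmx_normZ rmx_norm0_eq0.

End Norm.
End MatrixSpace.

(* Calculus and Riemannian geometry on a subset S of a finite-dimensional
   normed space V, in the extrinsic sense; S is meant to be an embedded
   submanifold. Functions on S are total functions on V whose values outside S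
   are irrelevant. *)
Section Submanifold.
Context {R : realType}.
Implicit Types V W : normedModType R.

Fixpoint Ck V W (U : set V) (k : nat) (G : V -> W) : Prop :=
  match k with
  | 0%N => forall x, U x -> {for x, continuous G}
  | k'.+1 => (forall x, U x -> differentiable G x) /\
             (forall v, Ck U k' (fun x => 'd G x v))
  end.

Definition smooth_on V W (S : set V) (F : V -> W) : Prop :=
  forall x, S x -> exists (U : set V) (G : V -> W),
    [/\ open U, U x, forall k, Ck U k G & forall y, U y -> S y -> F y = G y].

(* Tangent vectors are the velocities of curves in S that are differentiable at
   the base point, which for an embedded submanifold gives the tangent space. *)
Definition curve_at V (S : set V) (x v : V) (c : R -> V) : Prop :=
  [/\ forall t, S (c t), c 0 = x & is_derive (0 : R) 1 c v].

Definition tangent V (S : set V) (x v : V) : Prop :=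
  exists c, curve_at S x v c.

(* The derivative D_v F at x of a function F on S, for v tangent to S at x: the
   common value of (F o c)'(0) over the curves c of S with velocity v. *)
Definition dirD V W (S : set V) (F : V -> W) (x v : V) : W :=
  get [set w : W | forall c, curve_at S x v c ->
                             is_derive (0 : R) 1 (F \o c) w].

Definition vfield V (S : set V) (X : V -> V) : Prop :=
  smooth_on S X /\ forall x, S x -> tangent S x (X x).

(* nabla X Z stands for nabla_X Z, and nabla is unconstrained on functions that
   are not vector fields of S; existence, and uniqueness on vector fields, are
   the fundamental theorem of Riemannian geometry. m x is the metric at x. For
   vector fields of an embedded submanifold, [X, Z] = D_X Z - D_Z X. *)
Record levi_civita V (S : set V) (m : V -> V -> V -> R)
    (nabla : (V -> V) -> (V -> V) -> V -> V) : Prop := LeviCivita {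
  lc_vfield : forall X Z, vfield S X -> vfield S Z -> vfield S (nabla X Z);
  lc_linear : forall (a : V -> R) X X' Z, smooth_on S a ->
    vfield S X -> vfield S X' -> vfield S Z -> forall x, S x ->
    nabla (fun y => a y *: X y + X' y) Z x = a x *: nabla X Z x + nabla X' Z x;
  lc_leibniz : forall (a : V -> R) X Z Z', smooth_on S a ->
    vfield S X -> vfield S Z -> vfield S Z' -> forall x, S x ->
    nabla X (fun y => a y *: Z y + Z' y) x =
    dirD S a x (X x) *: Z x + a x *: nabla X Z x + nabla X Z' x;
  lc_torsion_free : forall X Z, vfield S X -> vfield S Z -> forall x, S x ->
    nabla X Z x - nabla Z X x = dirD S Z x (X x) - dirD S X x (Z x);
  lc_metric : forall X Z T, vfield S X -> vfield S Z -> vfield S T ->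
    forall x, S x ->
    dirD S (fun y => m y (Z y) (T y)) x (X x) =
    m x (nabla X Z x) (T x) + m x (Z x) (nabla X T x)
}.

End Submanifold.

(* The block sizes are p 0 = d_1, .., p (q-1) = d_q and p ord_max = d_(q+1), so
   that d is the sum of the p i and A_[ij] is submxblock A i j; only
   p ord_max may vanish. *)
Section Stiefel.
Context {R : realType} (F : ground) (n q : nat) (p : 'I_q.+1 -> nat).
Context (alpha0 alpha1 : R).
Local Notation K := (scal R F).
Local Notation d := (\sum_i p i)%N.
Local Notation E := (rmx K n d).

Definition symf (A : 'M[K]_d) : 'M[K]_d :=
  \mxblock_(i, j)
    (if (i != j) || (i == ord_max)
     then 2%:R^-1 *: (submxblock A i j + ctr (submxblock A j i))
     else submxblock A i j).

Definition stiefel : set E := [set Y : E | ctr Y *m Y = 1%:M].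

Definition Ugroup m : set 'M[K]_m := [set U | ctr U *m U = 1%:M].

Definition Uhat : set 'M[K]_d :=
  [set U | exists B : forall i, 'M[K]_(p i),
    [/\ forall i, i != ord_max -> Ugroup (B i), B ord_max = 1%:M
      & U = \mxdiag_i B i]].

Definition gop (Y w : E) : E :=
  alpha0 *: w + (alpha1 - alpha0) *: (Y *m ctr Y *m w : E).

Definition ginv (Y w : E) : E := get [set x : E | gop Y x = w].

Definition gmetric (Y v w : E) : R := inner v (gop Y w).

Definition Uorbit (Y : E) : set E := [set Y *m U | U in Uhat].

Definition horizontal (Y w : E) : Prop :=
  tangent stiefel Y w /\ forall v, tangent (Uorbit Y) Y v -> gmetric Y v w = 0.

Definition PiH (Y w : E) : E :=
  get [set h : E | horizontal Y h /\
                   forall k, horizontal Y k -> gmetric Y (w - h) k = 0].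

Definition Pi0 (Y : E) : 'M[K]_n := 1%:M - Y *m ctr Y.

(* The lifts of the (smooth) vector fields of the quotient are exactly the
   smooth horizontal fields that are equivariant under the group. *)
Definition hlift (X : E -> E) : Prop :=
  [/\ smooth_on stiefel X,
      forall Y, stiefel Y -> horizontal Y (X Y)
    & forall Y U, stiefel Y -> Uhat U -> X (Y *m U) = X Y *m U].

Definition Uinvariant (f : E -> R) : Prop :=
  forall Y U, stiefel Y -> Uhat U -> f (Y *m U) = f Y.

Definition ambient_gradient (f : E -> R) (fY : E -> E) : Prop :=
  smooth_on stiefel fY /\
  forall X, vfield stiefel X -> forall Y, stiefel Y ->
    inner (X Y) (fY Y) = dirD stiefel f Y (X Y).

(* w is the horizontal lift at Y of the gradient of f on the quotient *)
Definition is_rgrad (f : E -> R) (Y w : E) : Prop :=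
  horizontal Y w /\
  forall v, horizontal Y v -> gmetric Y v w = dirD stiefel f Y v.

Definition rgrad (fY : E -> E) (Y : E) : E := PiH Y (ginv Y (fY Y)).

Definition rhess11 (nabla : (E -> E) -> (E -> E) -> E -> E) (fY X : E -> E)
  (Y : E) : E := PiH Y (nabla X (rgrad fY) Y).

Definition rhess02 (nabla : (E -> E) -> (E -> E) -> E -> E)
  (fY X Z : E -> E) (Y : E) : R := gmetric Y (rhess11 nabla fY X Y) (Z Y).

End Stiefel.

Arguments stiefel R F n {q} p _.

(* Main.v *)
Require Import Defs.
From HB Require Import structures.
From mathcomp Require Import all_boot all_order all_algebra.
From mathcomp Require Import ring lra complex.
From mathcomp Require Import boolp classical_sets functions reals topology.
From mathcomp Require Import normedtype landau derive.
Set Implicit Arguments.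
Unset Strict Implicit.
Unset Printing Implicit Defensive.
Import Order.TTheory GRing.Theory Num.Theory.
Import numFieldNormedType.Exports.
Local Open Scope classical_set_scope.
Local Open Scope ring_scope.

(* Let D A be the part of A in the first q diagonal blocks. Then
   A_symf = (A + A^t)/2 + D (A - A^t)/2 is the orthogonal projection whose kernel
   consists of the antisymmetric A with D A = 0. Tangent vectors w of the Stiefel
   manifold, those with Y^t w antisymmetric, and tangent vectors of the orbits are
   realized by Cayley curves, and the horizontality condition becomes
   (Y^t w)_symf = 0.
   A connection that is metric and torsion free is determined by these two
   properties alone: the difference of two such is symmetric in its arguments and
   antisymmetric for the metric, hence zero. So it suffices to check that
   D_X Z + Y(X^t Z + Z^t X)/2 + (a0-a1)/a0 Pi0 (X Z^t + Z X^t) Y is metric, and the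
   horizontal formula follows by differentiating (Y^t Z)_symf = 0.
   For the Hessian, differentiate the product of the gradient with a horizontal
   field eta, which equals <fY, eta>, with the metric property; the operator form
   follows because every horizontal vector extends to the smooth horizontal field
   that projects it. *)

(** * Calculus with bounded bilinear maps *)

Section Calculus.
Context {R : realType}.
Implicit Types U V W : normedModType R.

(** The product rule needs continuity of [B], and an explicit bound is what can be checked directly
    for the norm of [rmx]. *)
Record bounded_bilinear U V W (B : U -> V -> W) : Prop := BoundedBilinear {
  bbl : forall z, linear (B^~ z);
  bbr : forall x, linear (B x);
  bb_bound : exists C : R, forall x z, `|B x z| <= C * (`|x| * `|z|)
}.

Record bounded_linear V W (L : V -> W) : Prop := BoundedLinear {
  bl_linear : linear L;
  bl_bound : exists C : R, forall x, `|L x| <= C * `|x|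
}.

(** Reduces linear maps to bilinear ones: every later fact about [L] follows by fixing the scalar
    argument to 1. *)
Lemma bounded_linear_bilinear V W (L : V -> W) :
  bounded_linear L -> bounded_bilinear (fun (a : R) x => a *: L x).
Proof.
move=> [lL [C hC]]; split.
- by move=> z a x y; rewrite scalerDl scalerA.
- move=> r a x y.
  by rewrite lL scalerDr !scalerA mulrC.
- exists C => a x; rewrite normrZ mulrCA ler_wpM2l //; exact: hC.
Qed.

Lemma bounded_bilinear_linear_r U V W (B : U -> V -> W) x :
  bounded_bilinear B -> bounded_linear (B x).
Proof.
move=> [_ Br [C hC]]; split; first exact: Br.
by exists (C * `|x|) => z; rewrite -mulrA.
Qed.

(** The increment splits as [B (x - a) y + B a (y - b)], and the bound sends both terms to 0. *)
Lemma bounded_bilinear_continuous U V W (B : U -> V -> W) :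
  bounded_bilinear B -> continuous (fun u : U * V => B u.1 u.2).
Proof.
move=> [Bl Br [C hC]] [a b].
have Bsub x y : B x y - B a b = B (x - a) y + B a (y - b).
  have BDl u v z : B (u - v) z = B u z - B v z.
    by rewrite -scaleN1r addrC (Bl z (-1)) scaleN1r addrC.
  have BDr z u v : B z (u - v) = B z u - B z v.
    by rewrite -scaleN1r addrC (Br z (-1)) scaleN1r addrC.
  by rewrite BDl BDr addrA subrK.
apply/subr_cvg0/norm_cvg0P => /=.
pose bnd (u : U * V) : R :=
  C * (`|u.1 - a| * `|u.2|) + C * (`|a| * `|u.2 - b|).
have hb : bnd u @[u --> (a, b)] --> 0.
  have c1 : (u : U * V).1 - a @[u --> (a, b)] --> 0.
    rewrite -(subrr a); apply: cvgB; [exact: cvg_fst|exact: cvg_cst].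
  have c2 : (u : U * V).2 @[u --> (a, b)] --> b by exact: cvg_snd.
  have c3 : (u : U * V).2 - b @[u --> (a, b)] --> 0.
    rewrite -[X in _ --> X](subrr b); apply: cvgB; [exact: c2|exact: cvg_cst].
  have -> : 0 = C * (`|0 : U| * `|b|) + C * (`|a| * `|0 : V|) :> R.
    by rewrite !normr0 mul0r !mulr0 addr0.
  apply: cvgD; (apply: cvgM; first exact: cvg_cst).
    by apply: cvgM; apply: cvg_norm.
  apply: cvgM; first exact: cvg_cst.
  exact: cvg_norm.
apply: (squeeze_cvgr _ _ hb); last exact: cvg_cst.
near=> u; rewrite normr_ge0 /= Bsub (le_trans (ler_normD _ _)) //.
by apply: lerD; exact: hC.
Unshelve. all: by end_near. Qed.

Lemma bounded_bilinear_is_diff (X U V W : normedModType R) (B : U -> V -> W) (G : X -> U)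
    (H : X -> V) (x : X) :
  bounded_bilinear B -> differentiable G x -> differentiable H x ->
  is_diff x (fun y => B (G y) (H y))
    (fun v => B ('d G x v) (H x) + B (G x) ('d H x v)).
Proof.
move=> bB dG dH; have cB := bounded_bilinear_continuous bB.
have biB : bilinear_for *:%R *:%R B.
  by split; [exact: bbl|exact: bbr].
pose B' : {bilinear U -> V -> W} :=
  HB.pack B (bilinear_isBilinear.Build R U V W _ _ B biB).
have dB : differentiable (fun u : U * V => B u.1 u.2) (G x, H x).
  exact: (@differentiable_bilin R U V W B' _ cB).
have dP := is_diff_pair (differentiableP dG) (differentiableP dH).
have := is_diff_comp dP (differentiableP dB).
move=> h; apply: is_diff_eq h _.
apply/funext => v /=.
by rewrite (@diff_bilin R U V W B' (G x, H x) cB) /= addrC.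
Qed.


(** Equal germs have the same remainder, and the differential is unique. This transfers
    differentials between functions that agree only on an open set. *)
Lemma is_diff_near (V W : normedModType R) (f g : V -> W) (x : V) :
  {near x, f =1 g} -> differentiable f x -> is_diff x g ('d f x).
Proof.
move=> fg df.
have fgx : f x = g x by exact: (nbhs_singleton fg).
have dgx : g \o shift x = cst (g x) + 'd f x +o_ 0 id.
  apply/eqaddoP => e e0; have := diff_locally df.
  move=> /eqaddoP /(_ _ e0) /=.
  have /= fg0 : \forall y \near 0, f (y + x) = g (y + x).
    have : y + x @[y --> (0 : V)] --> x.
      rewrite -[X in _ --> X]add0r; apply: cvgD; [exact: cvg_id|exact: cvg_cst].
    by move=> /(_ _ fg).
  move=> h; near=> y.
  have -> : (g \o shift x - (cst (g x) + 'd f x)) y =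
            (f \o shift x - (cst (f x) + 'd f x)) y.
    by rewrite /= -[LHS]/(g (y + x) - (g x + 'd f x y)) -fgx -(near fg0 y).
  by near: y.
have dfc := diff_continuous df.
have dE := diff_unique dfc dgx.
by split; [apply/diff_locallyP; rewrite dE; split|exact: dE].
Unshelve. all: by end_near. Qed.

Lemma Ck_ext V W (U : set V) k (f g : V -> W) :
  open U -> (forall x, U x -> f x = g x) -> Ck U k f -> Ck U k g.
Proof.
move=> oU; elim: k f g => [|k IH] f g fg /=.
  move=> cf x Ux; have := cf x Ux.
  rewrite /prop_for /continuous_at -(fg _ Ux); apply: cvg_trans; apply: near_eq_cvg.
  by have := open_nbhs_nbhs (conj oU Ux); apply: filterS => y /fg ->.
have nfg x : U x -> {near x, f =1 g}.
  by move=> Ux; have := open_nbhs_nbhs (conj oU Ux); apply: filterS => y /fg ->.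
move=> [df ddf]; split=> [x Ux|v].
  by have [] := is_diff_near (nfg x Ux) (df x Ux).
apply: IH (ddf v) => x Ux.
have dg := is_diff_near (nfg x Ux) (df x Ux).
exact: (esym (congr1 (fun h : V -> W => h v) (@diff_val _ _ _ _ _ _ _ dg))).
Qed.

Lemma Ck_pred V W (U : set V) k (f : V -> W) : Ck U k.+1 f -> Ck U k f.
Proof.
elim: k f => [|k IH] f [df ddf]; first by move=> x /df /differentiable_continuous.
by split=> // v; apply: IH.
Qed.

Lemma Ck_sub V W (U U' : set V) k (f : V -> W) : U' `<=` U -> Ck U k f -> Ck U' k f.
Proof.
move=> UU; elim: k f => [|k IH] f /=; first by move=> h x /UU; exact: h.
by move=> [df ddf]; split=> [x /UU|v]; [exact: df|exact: IH].
Qed.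

Lemma Ck_cst V W (U : set V) k (w : W) : Ck U k (cst w : V -> W).
Proof.
elim: k w => [|k IH] w /=; first by move=> x _; exact: cst_continuous.
split=> [x _|v]; first exact: differentiable_cst.
have -> : (fun x => 'd (cst w : V -> W) x v) = cst 0.
  by apply/funext => x; rewrite diff_cst.
exact: IH.
Qed.

Lemma Ck_id V (U : set V) k : Ck U k (id : V -> V).
Proof.
case: k => [|k] /=; first by move=> x _; exact: cvg_id.
split=> [x _|v]; first exact: ex_diff.
have -> : (fun x => 'd (id : V -> V) x v) = cst v by apply/funext => x; rewrite diff_val.
exact: Ck_cst.
Qed.

Lemma CkD V W (U : set V) k (f g : V -> W) : open U ->
  Ck U k f -> Ck U k g -> Ck U k (fun x => f x + g x).
Proof.
move=> oU; elim: k f g => [|k IH] f g /=.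
  by move=> cf cg x Ux; apply: cvgD; [exact: cf|exact: cg].
move=> [df ddf] [dg ddg]; split=> [x Ux|v].
  by apply: differentiableD; [exact: df|exact: dg].
apply: (Ck_ext oU _ (IH _ _ (ddf v) (ddg v))) => x Ux.
have dfg := is_diffD (differentiableP (df x Ux)) (differentiableP (dg x Ux)).
exact: (esym (congr1 (fun h : V -> W => h v) (@diff_val _ _ _ _ _ _ _ dfg))).
Qed.

(** Induction on [k]: the derivative in direction [v] is a sum of two expressions of the same shape
    with one factor differentiated; [Ck_pred] lowers the order of the other factor. *)
Lemma Ck_bilinear (X : normedModType R) U V W (B : U -> V -> W) (O : set X) k (f : X -> U)
    (g : X -> V) :
  bounded_bilinear B -> open O ->
  Ck O k f -> Ck O k g -> Ck O k (fun x => B (f x) (g x)).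
Proof.
move=> bB oO; elim: k f g => [|k IH] f g.
  move=> /= cf cg x Ox.
  have cc : {for (f x, g x), continuous (fun u : U * V => B u.1 u.2)}.
    exact: (bounded_bilinear_continuous bB).
  apply: (@continuous_comp _ _ _ (fun y => (f y, g y)) (fun u => B u.1 u.2)) => //.
  by apply: cvg_pair; [exact: cf|exact: cg].
move=> Cf Cg; have [df ddf] := Cf; have [dg ddg] := Cg.
split=> [x Ox|v].
  by have [] := bounded_bilinear_is_diff bB (df x Ox) (dg x Ox).
apply: (Ck_ext oO _ (CkD oO (IH _ _ (ddf v) (Ck_pred Cg)) (IH _ _ (Ck_pred Cf) (ddg v)))).
by move=> x Ox; have [_ ->] := bounded_bilinear_is_diff bB (df x Ox) (dg x Ox).
Qed.

(** * Smooth functions on a subset and their derivatives along curves *)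

Section Smooth.
Context {V : normedModType R} (S : set V).

Lemma smooth_cst W (w : W) : smooth_on S (cst w).
Proof.
by move=> x Sx; exists setT, (cst w); split=> // [|k]; [exact: openT|exact: Ck_cst].
Qed.

Lemma smooth_id : smooth_on S id.
Proof.
by move=> x Sx; exists setT, id; split=> // [|k]; [exact: openT|exact: Ck_id].
Qed.

Lemma smooth_ext W (f g : V -> W) :
  (forall x, S x -> f x = g x) -> smooth_on S f -> smooth_on S g.
Proof.
move=> fg sf x Sx; have [U [G [oU Ux CG fG]]] := sf x Sx.
by exists U, G; split=> // y Uy Sy; rewrite -fg // fG.
Qed.

Lemma smoothD W (f g : V -> W) :
  smooth_on S f -> smooth_on S g -> smooth_on S (fun x => f x + g x).
Proof.
move=> sf sg x Sx.
have [U [G [oU Ux CG fG]]] := sf x Sx.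
have [U' [G' [oU' Ux' CG' fG']]] := sg x Sx.
have oI := openI oU oU'.
exists (U `&` U'), (fun x => G x + G' x); split=> // [k|y [Uy Uy'] Sy].
  by apply: CkD => //; [apply: Ck_sub (CG k)|apply: Ck_sub (CG' k)] => y [].
by rewrite fG // fG'.
Qed.

Lemma smooth_bilinear U1 U2 W (B : U1 -> U2 -> W) (f : V -> U1) (g : V -> U2) :
  bounded_bilinear B ->
  smooth_on S f -> smooth_on S g -> smooth_on S (fun x => B (f x) (g x)).
Proof.
move=> bB sf sg x Sx.
have [U [G [oU Ux CG fG]]] := sf x Sx.
have [U' [G' [oU' Ux' CG' fG']]] := sg x Sx.
have oI := openI oU oU'.
exists (U `&` U'), (fun x => B (G x) (G' x)); split=> // [k|y [Uy Uy'] Sy].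
  by apply: Ck_bilinear => //; [apply: Ck_sub (CG k)|apply: Ck_sub (CG' k)] => y [].
by rewrite fG // fG'.
Qed.

Lemma smooth_linear U1 W (L : U1 -> W) (f : V -> U1) :
  bounded_linear L -> smooth_on S f -> smooth_on S (fun x => L (f x)).
Proof.
move=> bL sf.
have := smooth_bilinear (bounded_linear_bilinear bL) (smooth_cst (1 : R)) sf.
by apply: smooth_ext => x _; rewrite scale1r.
Qed.

Lemma smoothZ W (a : R) (f : V -> W) :
  smooth_on S f -> smooth_on S (fun x => a *: f x).
Proof.
apply: (@smooth_linear W W (fun x => a *: x)); split=> [b x y|].
  by rewrite scalerDr !scalerA mulrC.
by exists `|a| => x; rewrite normrZ.
Qed.

(** Near 0 the curve stays where a local extension [G] represents [F], so the chain rule gives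
    ['d G x v] for every curve. This common value is the witness for the [get] in [dirD]. *)
Lemma dirD_curve W (F : V -> W) x v c : smooth_on S F -> S x ->
  curve_at S x v c -> is_derive (0 : R) 1 (F \o c) (dirD S F x v).
Proof.
move=> sF Sx cc; have [U [G [oU Ux CG FG]]] := sF x Sx.
have dG : differentiable G x by have [dG _] := CG 1%N; exact: dG.
have key c' : curve_at S x v c' -> is_derive (0 : R) 1 (F \o c') ('d G x v).
  move=> [Sc c0 dc].
  have dc' : differentiable c' (0 : R) by apply/derivable1_diffP; exact: ex_derive.
  have GF : \forall t \near (0 : R), (G \o c') t = (F \o c') t.
    have : \forall t \near (0 : R), U (c' t).
      apply: (differentiable_continuous dc'); rewrite c0.
      exact: open_nbhs_nbhs.
    by apply: filterS => t Ut /=; rewrite FG.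
  apply: (near_eq_is_derive GF).
  rewrite -c0 in dG *.
  have dGc : differentiable (G \o c') (0 : R) by exact: differentiable_comp.
  split; first exact/derivable1_diffP.
  rewrite deriveE // diff_comp //=; congr ('d G _ _).
  by have <- := @derive_val _ _ _ _ _ _ _ dc; rewrite deriveE.
have := @getPex _ [set w : W | forall c, curve_at S x v c ->
  is_derive (0 : R) 1 (F \o c) w].
by apply; [exists ('d G x v); exact: key|exact: cc].
Unshelve. all: by end_near. Qed.

(** Tangency supplies a curve, and the derivative along it is unique, so the [get] can only return
    [w]. *)
Lemma dirD_curvesP W (F : V -> W) x v w : tangent S x v ->
  (forall c, curve_at S x v c -> is_derive (0 : R) 1 (F \o c) w) ->
  dirD S F x v = w.
Proof.
move=> [c cc] h.
have hh := @getPex _ [set w : W | forall c, curve_at S x v c ->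
  is_derive (0 : R) 1 (F \o c) w] (ex_intro _ w h) c cc.
have dw := h c cc.
by rewrite -(@derive_val _ _ _ _ _ _ _ dw) (@derive_val _ _ _ _ _ _ _ hh).
Qed.

Lemma dirD_ext W (F G : V -> W) x v :
  (forall y, S y -> F y = G y) -> dirD S F x v = dirD S G x v.
Proof.
move=> FG; rewrite /dirD; congr (get _); apply/seteqP; split=> w /= h c cc;
  have := h c cc; congr (is_derive _ _ _ _); apply/funext => t /=;
  by case: cc => Sc _ _; rewrite FG.
Qed.

End Smooth.

Lemma is_derive_bilinear U V W (B : U -> V -> W) (f : R -> U) (g : R -> V) t a b :
  bounded_bilinear B -> is_derive t (1 : R) f a -> is_derive t (1 : R) g b ->
  is_derive t (1 : R) (fun s => B (f s) (g s)) (B a (g t) + B (f t) b).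
Proof.
move=> bB df dg.
have Df : differentiable f t by apply/derivable1_diffP; exact: ex_derive.
have Dg : differentiable g t by apply/derivable1_diffP; exact: ex_derive.
have [h1 h2] := bounded_bilinear_is_diff bB Df Dg.
split; first exact/derivable1_diffP.
by rewrite deriveE // h2 -!deriveE // (@derive_val _ _ _ _ _ _ _ df)
  (@derive_val _ _ _ _ _ _ _ dg).
Qed.

Lemma is_derive_linear V W (L : V -> W) (f : R -> V) t a :
  bounded_linear L -> is_derive t (1 : R) f a ->
  is_derive t (1 : R) (fun s => L (f s)) (L a).
Proof.
move=> bL df.
have := is_derive_bilinear (bounded_linear_bilinear bL) (is_derive_cst (1 : R) t 1) df.
rewrite scale0r add0r scale1r.
by congr (is_derive _ _ _ _); apply/funext => s; rewrite scale1r.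
Qed.

Lemma is_derive_unique V (f : R -> V) t a b :
  is_derive t (1 : R) f a -> is_derive t (1 : R) f b -> a = b.
Proof.
move=> da db.
by rewrite -(@derive_val _ _ _ _ _ _ _ da) (@derive_val _ _ _ _ _ _ _ db).
Qed.

(** The difference quotient differs from [a] by at most [C] times the absolute value of [t]. *)
Lemma is_derive_quadratic V (f : R -> V) a C :
  (forall t, `|f t - f 0 - t *: a| <= C * t ^+ 2) -> is_derive (0 : R) (1 : R) f a.
Proof.
move=> fC.
suff h : (fun h : R => h^-1 *: ((f \o shift 0) (h *: 1) - f 0)) @ 0^' --> a.
  by split; [apply/cvg_ex; exists a|exact: cvg_lim].
apply/subr_cvg0/norm_cvg0P => /=.
have hb : C * `|t| @[t --> (0 : R)^'] --> 0.
  have e0 : C * `|0 : R| = 0 by rewrite normr0 mulr0.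
  rewrite -[X in _ --> X]e0.
  apply: cvgM; first exact: cvg_cst.
  have ct : t @[t --> (0 : R)^'] --> (0 : R) by exact: cvg_within.
  exact: cvg_norm ct.
apply: (squeeze_cvgr _ _ hb); last exact: cvg_cst.
near=> t; rewrite normr_ge0 /= addr0 [_ *: 1]mulr1.
have t0 : t != 0 by near: t; exact: nbhs_dnbhs_neq.
rewrite -[X in _ - X](scalerK t0) -scalerBr normrZ normfV ler_pdivrMl ?normr_gt0 //.
by rewrite mulrCA -normrM -expr2 ger0_norm ?sqr_ge0.
Unshelve. all: by end_near. Qed.

End Calculus.

(** * Matrices over a field with involution *)

Section StarMatrix.
Context {R : realType} (K : starField R).
Local Notation M := (rmx K).

Lemma scalemxRl m n k (a : R) (x : M m n) (y : 'M[K]_(n, k)) :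
  (a *: x) *m y = a *: (x *m y : M m k).
Proof. by rewrite -scalemxAl. Qed.

Lemma scalemxRr m n k (a : R) (x : 'M[K]_(m, n)) (y : M n k) :
  x *m (a *: y) = a *: (x *m y : M m k).
Proof. by rewrite -scalemxAr. Qed.

Lemma ctrM m n k (A : 'M[K]_(m, n)) (B : 'M[K]_(n, k)) :
  ctr (A *m B) = ctr B *m ctr A.
Proof. by rewrite /ctr trmx_mul map_mxM. Qed.

Lemma ctrDm m n (A B : 'M[K]_(m, n)) : ctr (A + B) = ctr A + ctr B.
Proof. exact: ctrD. Qed.

Lemma ctrKm m n (A : 'M[K]_(m, n)) : ctr (ctr A) = A.
Proof. exact: ctrK. Qed.

Lemma ctrZ m n (a : R) (A : M m n) : ctr (a *: A) = a *: (ctr A : M n m).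
Proof. by rewrite ctr_scale. Qed.

Lemma ctrN m n (A : 'M[K]_(m, n)) : ctr (- A) = - ctr A.
Proof. by rewrite /ctr linearN map_mxN. Qed.

Lemma ctrB m n (A B : 'M[K]_(m, n)) : ctr (A - B) = ctr A - ctr B.
Proof. by rewrite ctrDm ctrN. Qed.

Lemma ctr0 m n : ctr (0 : 'M[K]_(m, n)) = 0.
Proof. by rewrite /ctr trmx0 map_mx0. Qed.

Lemma ctr1 m : ctr (1%:M : 'M[K]_m) = 1%:M.
Proof. by rewrite /ctr trmx1 map_mx1. Qed.

Section Inner.
Variables m n : nat.
Implicit Types x y z : 'M[K]_(m, n).

Lemma innerNl x y : inner (- x) y = - inner x y.
Proof. by rewrite /inner mulNmx !raddfN. Qed.

Lemma innerNr x y : inner x (- y) = - inner x y.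
Proof. by rewrite innerC innerNl innerC. Qed.

Lemma innerDlm x y z : inner (x + y) z = inner x z + inner y z.
Proof. exact: innerDl. Qed.

Lemma innerDrm x y z : inner z (x + y) = inner z x + inner z y.
Proof. exact: innerDr. Qed.

Lemma innerBl x y z : inner (x - y) z = inner x z - inner y z.
Proof. by rewrite innerDlm innerNl. Qed.

Lemma innerBr x y z : inner z (x - y) = inner z x - inner z y.
Proof. by rewrite innerDrm innerNr. Qed.

Lemma inner0l x : inner (0 : 'M_(m, n)) x = 0.
Proof. by rewrite /inner mul0mx !raddf0. Qed.

Lemma inner0r x : inner x (0 : 'M_(m, n)) = 0.
Proof. by rewrite innerC inner0l. Qed.

Lemma inner_ctr x y : inner (ctr x) (ctr y) = inner x y.
Proof. by rewrite /inner ctrKm mxtrace_mulC -/(inner y x) innerC. Qed.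

Lemma inner_entries x y :
  inner x y = \sum_i \sum_j sre K (x i j * sconj K (y i j)).
Proof.
rewrite /inner /mxtrace raddf_sum; apply: eq_bigr => i _.
by rewrite !mxE raddf_sum; apply: eq_bigr => j _; rewrite !mxE.
Qed.

Lemma rmx_normE (x : M m n) : `|x| = Num.sqrt (inner x x).
Proof. by []. Qed.

Lemma sqr_rmx_norm (x : M m n) : `|x| ^+ 2 = inner x x.
Proof. by rewrite rmx_normE sqr_sqrtr // inner_ge0. Qed.

Lemma inner_bounded (x y : M m n) : `|inner x y| <= `|x| * `|y|.
Proof.
rewrite !rmx_normE -sqrtrM ?inner_ge0 // -sqrtr_sqr ler_wsqrtr //.
exact: cauchy_schwarz.
Qed.

End Inner.

Lemma innerZlm m n (a : R) (x y : M m n) :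
  inner (a *: x : M m n) y = a * inner x y.
Proof. exact: innerZl. Qed.

Lemma innerZrm m n (a : R) (x y : M m n) :
  inner x (a *: y : M m n) = a * inner x y.
Proof. exact: innerZr. Qed.

Definition inner_linear :=
  (innerDlm, innerDrm, innerNl, innerNr, innerZlm, innerZrm, inner0l, inner0r).

(* Together with inner_linear this reduces identities between real linear
   combinations of matrices to ring identities in R. *)
Lemma inner_inj m n (x y : 'M[K]_(m, n)) :
  (forall z, inner x z = inner y z) -> x = y.
Proof.
move=> h; apply/eqP; rewrite -subr_eq0; apply/eqP; apply: inner_eq0.
by rewrite innerBl h subrr.
Qed.

Lemma inner_mull m n k (A : 'M[K]_(m, n)) (x : 'M[K]_(n, k)) y :
  inner (A *m x) y = inner x (ctr A *m y).
Proof. by rewrite /inner ctrM ctrKm -mulmxA mxtrace_mulC -mulmxA. Qed.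

Lemma inner_mulr m n k (A : 'M[K]_(n, k)) (x : 'M[K]_(m, n)) y :
  inner (x *m A) y = inner x (y *m ctr A).
Proof. by rewrite /inner ctrM ctrKm mulmxA. Qed.

(** [ctr] preserves [inner], so the value equals its own opposite. *)
Lemma inner_sym_antisym m (a b : 'M[K]_m) :
  ctr a = a -> ctr b = - b -> inner a b = 0.
Proof. by move=> sa ab; have := inner_ctr a b; rewrite sa ab innerNr; lra. Qed.

Lemma inner_bilinear m n :
  bounded_bilinear (@inner R K m n : M m n -> M m n -> R).
Proof.
split.
- by move=> z a x y; rewrite innerDl innerZl.
- by move=> z a x y; rewrite innerDr innerZr.
- by exists 1 => x y; rewrite mul1r inner_bounded.
Qed.

Lemma ctr_linear m n : bounded_linear (@ctr R K m n : M m n -> M n m).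
Proof.
split; first by move=> a x y; rewrite ctrD ctrZ.
by exists 1 => x; rewrite mul1r !rmx_normE inner_ctr.
Qed.

(** An orthogonal projection has norm at most 1, since the square of the norm of [L x] is
    [inner x (L x)]. Serves [block_part] and [symf]. *)
Lemma projection_bounded m n (L : M m n -> M m n) :
  linear L -> (forall x, L (L x) = L x) ->
  (forall x y, inner (L x) y = inner x (L y)) -> bounded_linear L.
Proof.
move=> lL LL adjL; split=> //; exists 1 => x; rewrite mul1r.
have [->|x0] := eqVneq (L x) 0; first by rewrite normr0.
have p0 : 0 < `|L x| by rewrite normr_gt0.
rewrite -(ler_pM2l p0) -expr2 sqr_rmx_norm adjL LL innerC.
by apply: le_trans (ler_norm _) _; exact: inner_bounded.
Qed.

(** A row vector in the kernel satisfies [v = s *: (v *m W)], yet [v] is orthogonal to [v *m W];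
    hence [v = 0]. *)
Lemma unitmx_shift n (W : M n n) (s : R) :
  ctr W = - W -> (1%:M - s *: W : 'M[K]_n) \in unitmx.
Proof.
move=> aW; rewrite -row_free_unit; apply: inj_row_free => v.
rewrite mulmxBr mulmx1 scalemxRr => /eqP; rewrite subr_eq0 => /eqP vE.
have h : inner v (v *m W : 'rV_n) = 0.
  have := inner_mulr W v v; rewrite aW mulmxN innerNr innerC; lra.
apply: inner_eq0; rewrite {2}vE (@innerZr R K 1 n) h mulr0 //.
Qed.

(** [x] and [W *m x] are orthogonal, so the shift only adds a nonnegative term to the squared norm.
    It follows that the inverse of the shift does not increase norms. *)
Lemma shift_norm_le m n (W : M n n) (s : R) (x : M n m) :
  ctr W = - W -> `|x| <= `|(1%:M - s *: W) *m x : M n m|.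
Proof.
move=> aW; rewrite !rmx_normE ler_wsqrtr // mulmxBl mul1mx scalemxRl.
have h : inner x (W *m x) = 0.
  have := inner_mull W x x; rewrite aW mulNmx innerNr innerC; lra.
have h' : inner (W *m x) x = 0 by rewrite innerC.
rewrite -/(GRing.add _ _).
rewrite innerBl !innerBr !(@innerZl R K n m) !(@innerZr R K n m) h h'.
by rewrite mulr0 !subr0 sub0r opprK lerDl mulrA -expr2 mulr_ge0 ?sqr_ge0 ?inner_ge0.
Qed.

(* Used instead of the exponential of t W: unitarity is algebraic and the
   derivative at 0 follows from one explicit estimate. *)
Definition cayley n (W : M n n) (t : R) : M n n :=
  invmx (1%:M - (t / 2) *: W) *m (1%:M + (t / 2) *: W).

Lemma cayley0 n (W : M n n) : cayley W 0 = 1%:M.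
Proof. by rewrite /cayley mul0r scale0r subr0 addr0 invmx1 mulmx1. Qed.

(** [ctr] exchanges [1 - s W] and [1 + s W], and these two matrices commute. *)
Lemma cayley_unitary n (W : M n n) t :
  ctr W = - W -> ctr (cayley W t) *m cayley W t = 1%:M.
Proof.
move=> aW; rewrite /cayley; set s := t / 2.
have uN := unitmx_shift s aW.
have uP : (1%:M + s *: W : 'M[K]_n) \in unitmx.
  by have := unitmx_shift (- s) aW; rewrite scaleNr opprK.
have e : ctr (1%:M - s *: W) = 1%:M + s *: W.
  by rewrite ctrB ctr1 ctrZ aW scalerN opprK.
have e' : ctr (1%:M + s *: W) = 1%:M - s *: W.
  by rewrite ctrDm ctr1 ctrZ aW scalerN.
have eV : ctr (invmx (1%:M - s *: W)) = invmx (1%:M + s *: W).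
  have : ctr (1%:M - s *: W) *m ctr (invmx (1%:M - s *: W)) = 1%:M.
    by rewrite -ctrM mulVmx // ctr1.
  by rewrite e => h; rewrite -[LHS](mulKmx uP) h mulmx1.
have comm : (1%:M - s *: W) *m (1%:M + s *: W) = (1%:M + s *: W) *m (1%:M - s *: W).
  rewrite !(mulmxDl, mulmxDr, mulNmx, mulmxN, mul1mx, mulmx1).
  by apply: inner_inj => z; rewrite !inner_linear; ring.
have comm' : (1%:M - s *: W) *m invmx (1%:M + s *: W) =
    invmx (1%:M + s *: W) *m (1%:M - s *: W).
  apply: (can_inj (mulKmx uP)); rewrite mulKVmx //.
  by rewrite mulmxA -comm mulmxK.
by rewrite ctrM e' eV comm' -mulmxA mulKVmx // mulVmx.
Qed.

(** Multiplied by [1 - (t/2) W], the first-order error becomes exactly [(t^2/2) W^2 Y];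
    [shift_norm_le] removes the factor and leaves a quadratic bound. *)
Lemma cayley_derive m n (W : M n n) (Y : M n m) :
  ctr W = - W ->
  is_derive (0 : R) (1 : R) (fun t => cayley W t *m Y : M n m) (W *m Y : M n m).
Proof.
move=> aW; apply: (@is_derive_quadratic _ _ _ _ (2^-1 * `|W *m (W *m Y) : M n m|)) => t.
rewrite cayley0 mul1mx.
apply: le_trans (shift_norm_le (t / 2) _ aW) _.
have uN := unitmx_shift (t / 2) aW.
suff -> : ((1%:M - (t / 2) *: W) *m (cayley W t *m Y - Y - t *: (W *m Y : M n m)) : M n m) =
   (2^-1 * t ^+ 2) *: (W *m (W *m Y) : M n m).
  rewrite normrZ normrM ger0_norm ?invr_ge0 // ger0_norm ?sqr_ge0 //.
  by rewrite mulrAC.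
rewrite !mulmxBr /cayley !mulmxA mulmxV // mul1mx.
rewrite !(mulmxDl, mulNmx, mul1mx, scalemxRl, scalemxRr).
by apply: inner_inj => z; rewrite !inner_linear !mulmxA; field.
Qed.


End StarMatrix.

(** * Continuity of the matrix product, and block structure *)

Section MulContinuous.
Context {R : realType} (F : ground).
Local Notation K := (scal R F).
Local Notation M := (rmx K).

(** Multiplicativity of the squared modulus, the one place where the real and complex cases are
    computed separately. *)
Lemma sre_normM (x y : K) : sre K (x * y * sconj K (x * y)) =
  sre K (x * sconj K x) * sre K (y * sconj K y).
Proof.
case: F x y => /= [x y|[a b] [c e]]; first by ring.
by rewrite /=; ring.
Qed.

Definition scal_norm (x : K) : R := Num.sqrt (sre K (x * sconj K x)).

Lemma scal_normM x y : scal_norm (x * y) = scal_norm x * scal_norm y.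
Proof. by rewrite /scal_norm sre_normM sqrtrM // sre_norm_ge0. Qed.

(** A scalar is viewed as a 1 by 1 matrix, so that the triangle inequality is inherited from the
    norm of [rmx]. *)
Lemma scal_norm_mx x : scal_norm x = `|const_mx x : M 1 1|.
Proof. by rewrite rmx_normE inner_entries !big_ord1 !mxE. Qed.

Lemma scal_norm_sum n (f : 'I_n -> K) :
  scal_norm (\sum_i f i) <= \sum_i scal_norm (f i).
Proof.
rewrite scal_norm_mx.
have -> : (const_mx (\sum_i f i) : M 1 1) = \sum_i (const_mx (f i) : M 1 1).
  by apply/matrixP => i j; rewrite mxE summxE; apply: eq_bigr => k _; rewrite mxE.
apply: le_trans (ler_norm_sum _ _ _) _.
by apply: ler_sum => i _; rewrite scal_norm_mx.
Qed.

Lemma scal_norm_entry m n (A : M m n) i j : scal_norm (A i j) <= `|A|.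
Proof.
rewrite rmx_normE ler_wsqrtr // inner_entries (bigD1 i) //= (bigD1 j) //=.
rewrite -addrA lerDl addr_ge0 //; first by apply: sumr_ge0 => k _; exact: sre_norm_ge0.
by do 2![apply: sumr_ge0 => ? _]; exact: sre_norm_ge0.
Qed.

(** Each entry of the product is a sum of [n] terms bounded by the product of the norms, and there
    are [m * k] entries. The constant is crude; only its existence matters. *)
Lemma mulmx_bounded m n k (A : M m n) (B : M n k) :
  `|A *m B : M m k| <= Num.sqrt (m * k)%:R * n%:R * (`|A| * `|B|).
Proof.
set c := n%:R * (`|A| * `|B|).
have c0 : 0 <= c by rewrite !mulr_ge0.
have h i j : scal_norm ((A *m B) i j) <= c.
  rewrite mxE; apply: le_trans (scal_norm_sum _) _.
  rewrite /c mulr_natl -[X in _ *+ X]card_ord -sumr_const ler_sum // => l _.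
  by rewrite scal_normM ler_pM ?sqrtr_ge0 ?scal_norm_entry.
rewrite -mulrA -/c -[c in leRHS]ger0_norm // -sqrtr_sqr -sqrtrM //.
rewrite rmx_normE ler_wsqrtr // inner_entries natrM -mulrA mulr_natl.
rewrite -[X in _ *+ X]card_ord -sumr_const ler_sum // => i _.
rewrite mulr_natl -[X in _ *+ X]card_ord -sumr_const ler_sum // => j _.
rewrite -[leLHS]sqr_sqrtr ?sre_norm_ge0 // -/(scal_norm _).
by rewrite ler_sqr ?nnegrE ?sqrtr_ge0.
Qed.

Lemma mulmx_bilinear m n k :
  bounded_bilinear (@mulmx K m n k : M m n -> M n k -> M m k).
Proof.
split.
- by move=> z a x y; rewrite mulmxDl scalemxRl.
- by move=> x a y z; rewrite mulmxDr scalemxRr.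
- by exists (Num.sqrt (m * k)%:R * n%:R) => x z; exact: mulmx_bounded.
Qed.

End MulContinuous.

(** * The block projection, [symf], and the block-diagonal group *)

Section Blocks.
Context {R : realType} (F : ground) (q : nat) (p : 'I_q.+1 -> nat).
Local Notation K := (scal R F).
Local Notation M := (rmx K).
Local Notation d := (\sum_i p i)%N.
Implicit Types (A B : M d d) (i j : 'I_q.+1).

Definition free_block i j := (i == j) && (i != ord_max).

(** The projection D of the outline. The antisymmetric matrices that it fixes form the Lie algebra
    of [Uhat]. *)
Definition block_part (A : 'M[K]_d) : 'M[K]_d :=
  \mxblock_(i, j) (if free_block i j then submxblock A i j else 0).

Lemma block_partE A k l : block_part A k l =
  if free_block (tagnat.sig1 k) (tagnat.sig1 l) then A k l else 0.
Proof. by rewrite mxE; case: ifP => _; rewrite !mxE // !tagnat.sig2K. Qed.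

Lemma free_blockC i j : free_block i j = free_block j i.
Proof. by rewrite /free_block eq_sym; case: eqVneq => // ->. Qed.

Lemma block_partP A :
  (forall i j, ~~ free_block i j -> submxblock A i j = 0) <-> block_part A = A.
Proof.
split=> [h|h i j nf]; last by rewrite -h mxblockK (negbTE nf).
by apply/mxblockP => i j; rewrite mxblockK; case: ifPn => // /h.
Qed.

Lemma block_partN (A : 'M[K]_d) : block_part (- A) = - block_part A.
Proof.
apply/matrixP => k l; rewrite block_partE [RHS]mxE block_partE.
by case: ifP; rewrite ?oppr0 // mxE.
Qed.

Lemma block_partD (A B : 'M[K]_d) : block_part (A + B) = block_part A + block_part B.
Proof.
apply/matrixP => k l; rewrite block_partE [RHS]mxE !block_partE.
by case: ifP; rewrite ?addr0 // mxE.
Qed.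

Lemma block_partZ a A : block_part (a *: A) = a *: (block_part A : M d d).
Proof.
apply/matrixP => k l; rewrite block_partE [RHS]mxE block_partE.
by case: ifP; rewrite ?mulr0 // mxE.
Qed.

Lemma block_part_idem (A : 'M[K]_d) : block_part (block_part A) = block_part A.
Proof. by apply/matrixP => k l; rewrite !block_partE; case: (free_block _ _). Qed.

Lemma block_part_ctr (A : 'M[K]_d) : block_part (ctr A) = ctr (block_part A).
Proof.
have ctrE (X : 'M[K]_d) k l : ctr X k l = sconj K (X l k) by rewrite !mxE.
apply/matrixP => k l; rewrite block_partE !ctrE block_partE free_blockC.
by case: ifP => _; rewrite ?rmorph0.
Qed.

Lemma block_part_adj (A B : 'M[K]_d) : inner (block_part A) B = inner A (block_part B).
Proof.
rewrite !inner_entries; apply: eq_bigr => k _; apply: eq_bigr => l _.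
by rewrite !block_partE; case: ifP; rewrite // rmorph0 mul0r mulr0.
Qed.

Lemma sinj_half : sinj K 2^-1 = 2^-1.
Proof. by rewrite fmorphV rmorph_nat. Qed.

(** On a free block the two halves add up to [A]; elsewhere the second one vanishes. The algebra of
    [symf] then follows from that of [ctr] and [block_part]. *)
Lemma symfE (A : 'M[K]_d) : symf A =
  2^-1 *: (A + ctr A : M d d) + 2^-1 *: (block_part A - block_part (ctr A) : M d d).
Proof.
have two : 2 != 0 :> K.
  by rewrite -(rmorph_nat (sinj K)) fmorph_eq0 pnatr_eq0.
have dbl (x : K) : 2^-1 * (x + x) = x by rewrite -mulr2n -[x *+ 2]mulr_natl mulKf.
have sc (X : M d d) k l : (2^-1 *: X) k l = 2^-1 * X k l.
  by rewrite [LHS]mxE sinj_half.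
have addE (X Y : M d d) k l : (X + Y) k l = X k l + Y k l by rewrite mxE.
have oppE (X : M d d) k l : (- X) k l = - X k l by rewrite mxE.
apply/matrixP => k l; rewrite addE !sc !addE oppE !block_partE [LHS]mxE.
have -> : ((tagnat.sig1 k != tagnat.sig1 l) || (tagnat.sig1 k == ord_max)) =
  ~~ free_block (tagnat.sig1 k) (tagnat.sig1 l).
  by rewrite /free_block negb_and negbK.
case: (free_block _ _) => /=; rewrite !mxE !tagnat.sig2K.
  by rewrite -mulrDr addrACA subrr addr0 dbl.
by rewrite subr0 mulr0 addr0.
Qed.

Lemma symfD (A B : 'M[K]_d) : symf (A + B) = symf A + symf B.
Proof.
apply: inner_inj => Z.
by rewrite !symfE ctrDm !block_partD !inner_linear; ring.
Qed.

Lemma symfN (A : 'M[K]_d) : symf (- A) = - symf A.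
Proof.
apply: inner_inj => Z.
by rewrite !symfE ctrN !block_partN !inner_linear; ring.
Qed.

Lemma symfZ a A : symf (a *: A) = a *: (symf A : M d d).
Proof.
apply: inner_inj => Z.
by rewrite !symfE ctrZ !block_partZ !inner_linear; ring.
Qed.

(** [ctr] and [block_part] are self-adjoint and commute. *)
Lemma symf_adj (A B : 'M[K]_d) : inner (symf A) B = inner A (symf B).
Proof.
rewrite !symfE !inner_linear !block_part_adj.
rewrite -(inner_ctr (ctr A) B) -(inner_ctr (ctr A) (block_part B)) !ctrKm.
by rewrite -block_part_ctr; ring.
Qed.

Lemma symf_sym (A : 'M[K]_d) : ctr A = A -> symf A = A.
Proof.
by move=> sA; apply: inner_inj => Z; rewrite symfE sA !inner_linear; field.
Qed.

Lemma symf_antisym (A : 'M[K]_d) : ctr A = - A -> symf A = block_part A.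
Proof.
move=> sA; apply: inner_inj => Z.
by rewrite symfE sA block_partN !inner_linear; field.
Qed.

(** Of the two summands in [symfE], the first is symmetric and the second is antisymmetric and
    already fixed by [block_part]; [symf] fixes both. *)
Lemma symf_idem (A : 'M[K]_d) : symf (symf A) = symf A.
Proof.
rewrite [X in symf X]symfE symfD !symfZ symf_sym; last by rewrite ctrDm ctrKm addrC.
rewrite symf_antisym; last by rewrite ctrB !block_part_ctr ctrKm opprB.
by rewrite block_partD block_partN !block_part_idem -symfE.
Qed.

(** In [symf A + ctr (symf A)] the block terms cancel and [A + ctr A] remains, which gives
    antisymmetry. *)
Lemma symf_eq0P (A : 'M[K]_d) : symf A = 0 <-> ctr A = - A /\ block_part A = 0.
Proof.
split=> [h|[sA bA]]; last by rewrite symf_antisym.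
have sA : ctr A = - A.
  have h2 : symf A + ctr (symf A) = 0 by rewrite h ctr0 addr0.
  apply: inner_inj => Z; have := congr1 (fun X : 'M_d => inner X Z) h2.
  rewrite symfE !(ctrDm, ctrZ, ctrN) -!block_part_ctr !ctrKm !inner_linear.
  lra.
by split=> //; rewrite -symf_antisym.
Qed.

Lemma block_part_bounded : bounded_linear (@block_part : M d d -> M d d).
Proof.
apply: projection_bounded => [a x y|x|x y].
- by rewrite block_partD block_partZ.
- exact: block_part_idem.
- exact: block_part_adj.
Qed.

Lemma symf_bounded : bounded_linear (@symf R F q p : M d d -> M d d).
Proof.
apply: projection_bounded => [a x y|x|x y].
- by rewrite symfD symfZ.
- exact: symf_idem.
- exact: symf_adj.
Qed.

Lemma submxblock_ctr (A : 'M[K]_d) i j : submxblock (ctr A) i j = ctr (submxblock A j i).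
Proof. by apply/matrixP => k l; rewrite !mxE. Qed.

Lemma symf_eq0_blocks (A : 'M[K]_d) : symf A = 0 <->
  ctr A = - A /\ forall i, i != ord_max -> submxblock (symf A) i i = 0.
Proof.
split=> [h|[sA bA]].
  by have /symf_eq0P[sA _] := h; split=> // i _; rewrite h submxblock0.
apply/mxblockP => i j; rewrite submxblock0.
case: (boolP ((i != j) || (i == ord_max))) => h.
  by rewrite mxblockK h -submxblock_ctr -submxblockD sA subrr submxblock0 scaler0.
move: h; rewrite negb_or negbK => /andP[/eqP <-]; exact: bA.
Qed.

Lemma mul_mxdiag (A B : forall i, 'M[K]_(p i)) :
  \mxdiag_i A i *m \mxdiag_i B i = \mxdiag_i (A i *m B i).
Proof.
rewrite mul_mxdiag_mxblock; apply/mxblockP => i j; rewrite !mxblockK.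
by case: eqVneq => [<-|_]; rewrite ?mulmx0 // !conform_mx_id.
Qed.

Lemma block_part_mxdiag A : block_part A = A -> \mxdiag_i submxblock A i i = A.
Proof.
move=> /block_partP h; apply/mxblockP => i j; rewrite mxblockK.
case: eqVneq => [<-|ij]; first by rewrite conform_mx_id.
by rewrite h // /free_block (negbTE ij).
Qed.

(** Subtracting the identity clears the last block and gives a linear condition, ready to be
    differentiated along a curve in the group. *)
Lemma Uhat_block_part (U : 'M[K]_d) :
  Uhat U -> block_part (U - 1%:M) = U - 1%:M.
Proof.
move=> [B [_ B1 ->]]; rewrite -mxdiagZ -mxdiagB; apply/block_partP => i j.
rewrite negb_and negbK => h.
case: (eqVneq i j) h => [<-|ij _]; last by rewrite mxblockK (negbTE ij).
by move=> /= /eqP ->; rewrite submxblock_diag B1 subrr.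
Qed.

(** The Cayley transform acts block by block, and the zero last block of [A] becomes an identity
    block. Cancelling [1 - (t/2) A] avoids inverting a block matrix. *)
Lemma Uhat_cayley A t :
  ctr A = - A -> block_part A = A -> Uhat (cayley A t).
Proof.
move=> sA bA; pose D i : M (p i) (p i) := submxblock A i i.
have sD i : ctr (D i) = - D i by rewrite -submxblock_ctr sA submxblockN.
have DE : \mxdiag_i D i = A by exact: block_part_mxdiag.
have DZ (s : R) : \mxdiag_i (s *: D i) = s *: A.
  rewrite -DE; have e i : s *: D i = (sinj K s)%:M *m D i by rewrite mul_scalar_mx.
  rewrite (eq_mxdiag e) -mul_mxdiag mxdiagZ mul_scalar_mx //.
exists (fun i => cayley (D i) t); split.
- by move=> i _; exact: cayley_unitary.
- have -> : D ord_max = 0.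
    by move/block_partP: bA; apply; rewrite /free_block eqxx andbF.
  by rewrite /cayley !scaler0 subr0 addr0 invmx1 mulmx1.
- have uA := unitmx_shift (t / 2) sA.
  apply: (can_inj (mulKmx uA)); rewrite /cayley mulKVmx //.
  rewrite -DZ -mxdiagZ -mxdiagB -mxdiagD mul_mxdiag.
  by apply: eq_mxdiag => i; rewrite mulKVmx // unitmx_shift.
Qed.

End Blocks.

(** * Tangent and horizontal spaces, projection, gradient *)

Section StiefelTangent.
Context {R : realType} (F : ground) (n q : nat) (p : 'I_q.+1 -> nat).
Local Notation K := (scal R F).
Local Notation M := (rmx K).
Local Notation d := (\sum_i p i)%N.
Local Notation E := (M n d).
Local Notation St := (stiefel R F n p).
Implicit Types (Y v w x z : E).

(* Chosen so that W Y = w: the field Z |-> W Z then extends w, and so does the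
   Cayley curve of W through Y. *)
Definition skew_extension Y w : M n n :=
  w *m ctr Y - Y *m ctr w - Y *m (ctr Y *m w) *m ctr Y.

Lemma stiefelE Y : St Y -> ctr Y *m Y = 1%:M.
Proof. by []. Qed.

Lemma skew_extension_antisym Y w : ctr (ctr Y *m w) = - (ctr Y *m w) ->
  ctr (skew_extension Y w) = - skew_extension Y w.
Proof.
rewrite /skew_extension; move: (ctr Y *m w) => a aa.
rewrite !ctrB !ctrM !ctrKm aa mulNmx mulmxN mulmxA.
by apply: inner_inj => u; rewrite !inner_linear; ring.
Qed.

Lemma skew_extension_val Y w : St Y -> ctr (ctr Y *m w) = - (ctr Y *m w) ->
  skew_extension Y w *m Y = w.
Proof.
move=> /stiefelE YY aw.
have wY : ctr w *m Y = - (ctr Y *m w) by rewrite -aw ctrM ctrKm.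
rewrite /skew_extension !mulmxDl !mulNmx -!mulmxA YY wY !mulmx1 mulmxN opprK.
by rewrite addrK.
Qed.

(** Forwards, differentiate [ctr (c t) *m c t = 1]; backwards, follow the Cayley curve of the skew
    extension. *)
Lemma tangent_stiefelP Y w : St Y ->
  tangent St Y w <-> ctr (ctr Y *m w) = - (ctr Y *m w).
Proof.
move=> YY; split=> [[c [Sc c0 dc]]|aw].
  have dcc := is_derive_bilinear (mulmx_bilinear F d n d)
    (is_derive_linear (ctr_linear K n d) dc) dc.
  have cE : (fun t => ctr (c t) *m c t) = cst (1%:M : M d d).
    by apply/funext => t; exact: Sc.
  rewrite cE c0 in dcc.
  have := is_derive_unique dcc (is_derive_cst (1%:M : M d d) (0 : R) (1 : R)).
  by rewrite ctrM ctrKm => /eqP; rewrite addr_eq0 => /eqP.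
have aW := skew_extension_antisym aw.
exists (fun t => cayley (skew_extension Y w) t *m Y); split=> [t||].
- rewrite /stiefel /= ctrM -mulmxA [X in _ *m X]mulmxA cayley_unitary //.
  by rewrite mul1mx; exact: YY.
- by rewrite cayley0 mul1mx.
- by rewrite -[X in is_derive _ _ _ X](skew_extension_val YY aw); exact: cayley_derive.
Qed.

Lemma vfield_skew (W : M n n) : ctr W = - W -> vfield St (fun Y : E => W *m Y : E).
Proof.
move=> aW; split=> [|Y YY].
  apply: (smooth_bilinear (mulmx_bilinear F n n d)); [exact: smooth_cst|exact: smooth_id].
by apply/(tangent_stiefelP _ YY); rewrite !ctrM ctrKm aW mulmxN mulNmx mulmxA.
Qed.

(** Connections and ambient gradients are specified on vector fields; this makes them applicable to
    a single tangent vector. *)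
Lemma tangent_vfield Y w : St Y -> tangent St Y w ->
  exists2 X, vfield St X & X Y = w.
Proof.
move=> YY /(tangent_stiefelP _ YY) aw.
exists (fun Z => skew_extension Y w *m Z); last exact: skew_extension_val.
exact/vfield_skew/skew_extension_antisym.
Qed.

Lemma sub_orbit_stiefel Y : St Y -> Uorbit Y `<=` St.
Proof.
move=> YY Z [U [B [uB B1 ->]] <-]; rewrite /stiefel /= ctrM -mulmxA [X in _ *m X]mulmxA.
rewrite stiefelE // mul1mx.
have -> : ctr (\mxdiag_i B i) = \mxdiag_i ctr (B i).
  apply/mxblockP => i j; rewrite submxblock_ctr !mxblockK.
  rewrite eq_sym; case: eqVneq => [->|_]; first by rewrite !conform_mx_id.
  by rewrite ctr0.
rewrite mul_mxdiag -mxdiagZ; apply: eq_mxdiag => i.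
case: (eqVneq i ord_max) => [->|/uB //]; by rewrite B1 ctr1 mulmx1.
Qed.

(** Each conclusion is the derivative of a relation along an orbit curve: membership in the Stiefel
    manifold, the block form of [ctr Y *m c t], and [Y *m (ctr Y *m c t) = c t]. *)
Lemma tangent_orbit Y v : St Y -> tangent (Uorbit Y) Y v ->
  [/\ ctr (ctr Y *m v) = - (ctr Y *m v), block_part (ctr Y *m v) = ctr Y *m v
    & Y *m (ctr Y *m v) = v].
Proof.
move=> YY [c [Oc c0 dc]].
have bY := bounded_bilinear_linear_r (ctr Y : M d n) (mulmx_bilinear F d n d).
have dYc : is_derive (0 : R) (1 : R) (fun t => ctr Y *m c t : M d d) (ctr Y *m v : M d d).
  exact: (is_derive_linear bY dc).
split.
- by apply/(tangent_stiefelP _ YY); exists c; split=> // t; exact: sub_orbit_stiefel (Oc t).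
- have d1 := is_deriveB (is_derive_linear (block_part_bounded F p) dYc) dYc.
  (* [ctr Y *m c t] lies in [Uhat]; the constant is minus the identity in the last block and zero
     elsewhere. *)
  have cE : (fun t => block_part (ctr Y *m c t) : M d d) - (fun t => ctr Y *m c t : M d d) =
      cst (block_part (1%:M) - 1%:M : M d d).
    apply/funext => t; rewrite -[LHS]/(block_part (ctr Y *m c t) - ctr Y *m c t).
    have [U hU <-] := Oc t; rewrite mulmxA stiefelE // mul1mx.
    have /eqP := Uhat_block_part hU.
    rewrite block_partD block_partN subr_eq => /eqP h.
    apply: inner_inj => X; have := congr1 (fun u : 'M_d => inner u X) h.
    rewrite /cst !inner_linear; lra.
  rewrite cE in d1.
  have := is_derive_unique d1 (is_derive_cst (block_part (1%:M) - 1%:M : M d d) (0 : R) (1 : R)).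
  by move/eqP; rewrite subr_eq0 => /eqP.
- have bY' := bounded_bilinear_linear_r (Y : M n d) (mulmx_bilinear F n d d).
  have d1 := is_derive_linear bY' dYc.
  have cE : (fun t => Y *m (ctr Y *m c t)) = c.
    apply/funext => t; have [U _ <-] := Oc t.
    by rewrite [ctr Y *m _]mulmxA stiefelE // mul1mx.
  rewrite cE in d1; exact: is_derive_unique d1 dc.
Qed.

Lemma tangent_orbit_skew Y (A : M d d) : ctr A = - A -> block_part A = A ->
  tangent (Uorbit Y) Y (Y *m A).
Proof.
move=> aA bA; exists (fun t => Y *m cayley A t); split=> [t||].
- by exists (cayley A t) => //; exact: Uhat_cayley.
- by rewrite cayley0 mulmx1.
- have bY := bounded_bilinear_linear_r (Y : M n d) (mulmx_bilinear F n d d).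
  have := is_derive_linear bY (cayley_derive (1%:M : M d d) aA).
  rewrite mulmx1; congr (is_derive _ _ _ _).
  by apply/funext => t; rewrite mulmx1.
Qed.

(** * The metric, horizontality and the horizontal projection *)

Context (alpha0 alpha1 : R) (halpha0 : 0 < alpha0) (halpha1 : 0 < alpha1).
Local Notation gop := (gop alpha0 alpha1).
Local Notation ginv := (ginv alpha0 alpha1).
Local Notation g := (gmetric alpha0 alpha1).
Local Notation H := (horizontal alpha0 alpha1).
Local Notation Pi := (PiH alpha0 alpha1).

Lemma gmetricE Y v w :
  g Y v w = alpha0 * inner v w + (alpha1 - alpha0) * inner (ctr Y *m v) (ctr Y *m w).
Proof.
rewrite /gmetric /gop innerDr !innerZr -mulmxA; congr (_ + _ * _).
by rewrite innerC inner_mull innerC.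
Qed.

Lemma gmetricC Y v w : g Y v w = g Y w v.
Proof. by rewrite !gmetricE innerC (innerC (ctr Y *m v)). Qed.

Lemma gmetricDl Y v w z : g Y (v + w) z = g Y v z + g Y w z.
Proof. by rewrite !gmetricE mulmxDr !inner_linear; ring. Qed.

Lemma gmetricNl Y v w : g Y (- v) w = - g Y v w.
Proof. by rewrite !gmetricE mulmxN !inner_linear; ring. Qed.

Lemma gmetric_vertical Y (A : 'M[K]_d) w : St Y ->
  g Y (Y *m A) w = alpha1 * inner A (ctr Y *m w).
Proof. by move=> YY; rewrite gmetricE mulmxA stiefelE // mul1mx inner_mull; ring. Qed.

(** With [v = u + Y *m a] and [ctr Y *m u = 0], the metric is
    [alpha0 * inner u u + alpha1 * inner a a]. It is thus definite on all of [E], beyond tangent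
    vectors. *)
Lemma gmetric_eq0 Y v : St Y -> g Y v v = 0 -> v = 0.
Proof.
move=> YY.
have [u [a [vE Yu aE]]] :
    exists (u : E) (a : M d d), [/\ v = u + Y *m a, ctr Y *m u = 0 & ctr Y *m v = a].
  exists (v - Y *m (ctr Y *m v)), (ctr Y *m v); split=> //; first by rewrite subrK.
  by rewrite mulmxBr [ctr Y *m (Y *m _)]mulmxA stiefelE // mul1mx subrr.
have uu : inner v v = inner u u + inner a a.
  rewrite vE !inner_linear (innerC u) !inner_mull Yu !inner0r mulmxA stiefelE // mul1mx.
  by rewrite !addr0 add0r.
rewrite gmetricE aE uu => h.
have h0 := mulr_ge0 (ltW halpha0) (inner_ge0 u).
have h1 := mulr_ge0 (ltW halpha1) (inner_ge0 a).
have u0 : inner u u = 0.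
  have /eqP : alpha0 * inner u u = 0 by lra.
  by rewrite mulf_eq0 gt_eqF //= => /eqP.
have a0 : inner a a = 0.
  have /eqP : alpha1 * inner a a = 0 by lra.
  by rewrite mulf_eq0 gt_eqF //= => /eqP.
by rewrite vE (inner_eq0 u0) (inner_eq0 a0) mulmx0 addr0.
Qed.

(** At a Stiefel point [gop Y] is [alpha1] on the range of the projection [Y *m ctr Y] and [alpha0]
    on its complement; here the eigenvalues are inverted. *)
Definition ginv_formula Y w : E :=
  alpha0^-1 *: w + (alpha1^-1 - alpha0^-1) *: (Y *m ctr Y *m w : E).

Lemma gop_formula Y w : St Y -> gop Y (ginv_formula Y w) = w.
Proof.
move=> YY; have P2 : Y *m ctr Y *m (Y *m ctr Y *m w) = Y *m ctr Y *m w.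
  by rewrite !mulmxA -(mulmxA Y) stiefelE // mulmx1.
apply: inner_inj => z.
rewrite /gop /ginv_formula mulmxDr !scalemxRr P2 !inner_linear.
by field; rewrite !gt_eqF.
Qed.

Lemma gop_inj Y v w : St Y -> gop Y v = gop Y w -> v = w.
Proof.
move=> YY e; apply/eqP; rewrite -subr_eq0; apply/eqP/(gmetric_eq0 YY).
by rewrite gmetricDl gmetricNl (gmetricC Y v) (gmetricC Y w) /gmetric e subrr.
Qed.

Lemma ginvE Y w : St Y -> ginv Y w = ginv_formula Y w.
Proof.
move=> YY; have h := @getPex _ [set x : E | gop Y x = w]
  (ex_intro _ _ (gop_formula w YY)).
by apply: (gop_inj YY); rewrite gop_formula.
Qed.

Lemma gmetric_ginv Y v w : St Y -> g Y v (ginv Y w) = inner v w.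
Proof. by move=> YY; rewrite ginvE // /gmetric gop_formula. Qed.

(** Testing orthogonality against the orbit vector [Y *m block_part (ctr Y *m w)] yields the squared
    norm of [block_part (ctr Y *m w)], which must vanish. *)
Lemma horizontalP Y w : St Y -> H Y w <-> symf (ctr Y *m w) = 0.
Proof.
move=> YY; split=> [[/(tangent_stiefelP _ YY) aw ow]|/symf_eq0P [aw bw]].
  apply/symf_eq0P; split=> //.
  have aA : ctr (block_part (ctr Y *m w)) = - block_part (ctr Y *m w).
    by rewrite -block_part_ctr aw block_partN.
  have := ow _ (tangent_orbit_skew Y aA (block_part_idem _)).
  rewrite gmetric_vertical // => /eqP; rewrite mulf_eq0 gt_eqF //= => /eqP h.
  by apply: inner_eq0; rewrite -block_part_adj block_part_idem.
split; first exact/(tangent_stiefelP _ YY).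
move=> v /(tangent_orbit YY) [av bv vE].
by rewrite -vE gmetric_vertical // -bv block_part_adj bw inner0r mulr0.
Qed.

Lemma horizontal_tangent Y w : H Y w -> tangent St Y w.
Proof. by case. Qed.

Definition PiH_formula Y w : E := w - Y *m symf (ctr Y *m w).

Lemma PiH_formula_horizontal Y w : St Y -> H Y (PiH_formula Y w).
Proof.
move=> YY; apply/horizontalP => //.
rewrite /PiH_formula mulmxBr mulmxA stiefelE // mul1mx.
by rewrite symfD symfN symf_idem subrr.
Qed.

Lemma gmetric_vertical_symf Y w v : St Y -> H Y v ->
  g Y (Y *m symf (ctr Y *m w)) v = 0.
Proof.
move=> YY /(horizontalP _ YY) hv.
by rewrite gmetric_vertical // symf_adj hv inner0r mulr0.
Qed.

Lemma horizontalB Y v w : St Y -> H Y v -> H Y w -> H Y (v - w).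
Proof.
move=> YY /(horizontalP _ YY) hv /(horizontalP _ YY) hw; apply/horizontalP => //.
by rewrite mulmxBr symfD symfN hv hw subrr.
Qed.

(** The difference of two candidates is horizontal and orthogonal to every horizontal vector, itself
    included. *)
Lemma PiHE Y w : St Y -> Pi Y w = PiH_formula Y w.
Proof.
move=> YY; have hf := PiH_formula_horizontal w YY.
have orthf k : H Y k -> g Y (w - PiH_formula Y w) k = 0.
  by move=> hk; rewrite /PiH_formula opprB addrC subrK; exact: gmetric_vertical_symf.
have [hP oP] := @getPex _ [set h : E | H Y h /\ forall k, H Y k -> g Y (w - h) k = 0]
  (ex_intro _ _ (conj hf orthf)).
rewrite -/(Pi Y w) in hP oP.
have hD := horizontalB YY hP hf.
apply/eqP; rewrite -subr_eq0; apply/eqP/(gmetric_eq0 YY).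
have e : Pi Y w - PiH_formula Y w = (w - PiH_formula Y w) - (w - Pi Y w).
  by apply: inner_inj => z; rewrite !inner_linear; ring.
by rewrite {1}e gmetricDl gmetricNl orthf // oP // subrr.
Qed.

Lemma PiH_horizontal Y w : St Y -> H Y (Pi Y w).
Proof. by move=> YY; rewrite PiHE //; exact: PiH_formula_horizontal. Qed.

Lemma gmetric_PiH Y w v : St Y -> H Y v -> g Y (Pi Y w) v = g Y w v.
Proof.
move=> YY hv; rewrite PiHE // /PiH_formula gmetricDl gmetricNl.
by rewrite gmetric_vertical_symf // subr0.
Qed.

Lemma horizontal_inj Y v w : St Y -> H Y v -> H Y w ->
  (forall k, H Y k -> g Y v k = g Y w k) -> v = w.
Proof.
move=> YY hv hw h; apply/eqP; rewrite -subr_eq0; apply/eqP/(gmetric_eq0 YY).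
by rewrite gmetricDl gmetricNl h ?subrr //; exact: horizontalB.
Qed.

Lemma rgradE fY Y : St Y -> rgrad alpha0 alpha1 fY Y =
  alpha0^-1 *: fY Y
  + (alpha1^-1 - alpha0^-1) *: (Y *m ctr Y *m fY Y : E)
  - alpha1^-1 *: (Y *m symf (ctr Y *m fY Y) : E).
Proof.
move=> YY; rewrite /rgrad PiHE // ginvE // /PiH_formula; congr (_ - _).
(* After multiplication by [ctr Y] the two [alpha0^-1] terms cancel because [ctr Y *m Y = 1]. *)
have -> : ctr Y *m ginv_formula Y (fY Y) = alpha1^-1 *: (ctr Y *m fY Y : M d d).
  rewrite /ginv_formula mulmxDr !scalemxRr !mulmxA stiefelE // mul1mx.
  by apply: inner_inj => z; rewrite !inner_linear; ring.
by rewrite symfZ scalemxRr.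
Qed.

End StiefelTangent.

(** * Levi-Civita connection *)

Section LeviCivita.
Context {R : realType} (F : ground) (n q : nat) (p : 'I_q.+1 -> nat).
Local Notation K := (scal R F).
Local Notation M := (rmx K).
Local Notation d := (\sum_i p i)%N.
Local Notation E := (M n d).
Local Notation St := (stiefel R F n p).
Context (alpha0 alpha1 : R) (halpha0 : 0 < alpha0) (halpha1 : 0 < alpha1).
Local Notation g := (gmetric alpha0 alpha1).
Local Notation H := (horizontal alpha0 alpha1).
Local Notation Pi := (PiH alpha0 alpha1).
Local Notation beta := ((alpha0 - alpha1) / alpha0).
Implicit Types (Y v w x z u : E) (X Z T : E -> E).

Definition second_order Y x z : E :=
  beta *: (Pi0 Y *m (x *m ctr z + z *m ctr x) *m Y : E).

(** The first summand makes [dirD] of a vector field tangent again; the second corrects for unequal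
    [alpha0] and [alpha1]. *)
Definition christoffel Y x z : E :=
  2^-1 *: (Y *m (ctr x *m z + ctr z *m x) : E) + second_order Y x z.

Lemma second_orderC Y x z : second_order Y x z = second_order Y z x.
Proof. by rewrite /second_order (addrC (x *m _)). Qed.

Lemma christoffelC Y x z : christoffel Y x z = christoffel Y z x.
Proof. by rewrite /christoffel second_orderC (addrC (ctr x *m _)). Qed.

Lemma ctr_Pi0 Y : ctr (Pi0 Y) = Pi0 Y.
Proof. by rewrite /Pi0 ctrB ctr1 ctrM ctrKm. Qed.

Lemma ctr_mul_Pi0 Y : St Y -> ctr Y *m Pi0 Y = 0.
Proof. by move=> YY; rewrite mulmxBr mulmx1 mulmxA stiefelE // mul1mx subrr. Qed.

Lemma ctr_second_order Y x z : St Y -> ctr Y *m second_order Y x z = 0.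
Proof.
by move=> YY; rewrite /second_order scalemxRr !mulmxA ctr_mul_Pi0 // !mul0mx scaler0.
Qed.

Lemma ctr_christoffel Y x z : St Y ->
  ctr Y *m christoffel Y x z = 2^-1 *: (ctr x *m z + ctr z *m x : M d d).
Proof.
move=> YY; rewrite /christoffel [LHS]mulmxDr ctr_second_order // addr0 scalemxRr.
by rewrite mulmxA stiefelE // mul1mx.
Qed.

(** The first summand pairs a symmetric matrix with the antisymmetric [ctr Y *m w] and drops out;
    the factor [alpha0] of the metric clears the denominator in the second. *)
Lemma gmetric_christoffel Y x z w : St Y -> ctr (ctr Y *m w) = - (ctr Y *m w) ->
  g Y (christoffel Y x z) w =
  (alpha0 - alpha1) * inner ((x *m ctr z + z *m ctr x) *m Y) (Pi0 Y *m w).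
Proof.
move=> YY aw; rewrite gmetricE ctr_christoffel // innerZlm.
have s0 : inner (ctr x *m z + ctr z *m x) (ctr Y *m w) = 0.
  by apply: inner_sym_antisym aw; rewrite ctrDm !ctrM !ctrKm addrC.
rewrite s0 /christoffel innerDlm innerZlm inner_mull s0 /second_order innerZlm.
rewrite -mulmxA inner_mull ctr_Pi0.
by field; rewrite gt_eqF.
Qed.

(** Metric compatibility at a point: the right side is the derivative of the metric at fixed [z] and
    [w] as the base point moves along [x]. *)
Lemma christoffel_metric Y x z w : St Y -> ctr (ctr Y *m x) = - (ctr Y *m x) ->
  ctr (ctr Y *m z) = - (ctr Y *m z) -> ctr (ctr Y *m w) = - (ctr Y *m w) ->
  g Y (christoffel Y x z) w + g Y z (christoffel Y x w) =
  (alpha1 - alpha0) * (inner (ctr x *m z) (ctr Y *m w) + inner (ctr Y *m z) (ctr x *m w)).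
Proof.
move=> YY; set a := ctr Y *m x; set b := ctr Y *m z; set c := ctr Y *m w => aa ab ac.
rewrite (gmetricC _ _ Y z) !gmetric_christoffel //.
(* Expands [Pi0] and moves [ctr] onto [Y] by antisymmetry; the remaining trilinear terms are matched
   by [e1] to [e5]. *)
have key y z' w' : ctr (ctr Y *m z') = - (ctr Y *m z') ->
  ctr (ctr Y *m y) = - (ctr Y *m y) ->
  inner ((y *m ctr z' + z' *m ctr y) *m Y) (Pi0 Y *m w') =
  - (inner (y *m (ctr Y *m z')) w' + inner (z' *m (ctr Y *m y)) w'
     - inner ((ctr Y *m y) *m (ctr Y *m z')) (ctr Y *m w')
     - inner ((ctr Y *m z') *m (ctr Y *m y)) (ctr Y *m w')).
  move=> az' ay.
  have e : (y *m ctr z' + z' *m ctr y) *m Y =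
      - (y *m (ctr Y *m z') + z' *m (ctr Y *m y)).
    rewrite mulmxDl -!mulmxA.
    have -> : ctr z' *m Y = - (ctr Y *m z') by rewrite -az' ctrM ctrKm.
    have -> : ctr y *m Y = - (ctr Y *m y) by rewrite -ay ctrM ctrKm.
    by rewrite !mulmxN opprD.
  rewrite e /Pi0 mulmxBl mul1mx -(mulmxA Y) !inner_linear.
  have t u : inner u (Y *m (ctr Y *m w')) = inner (ctr Y *m u) (ctr Y *m w').
    by rewrite innerC inner_mull innerC.
  by rewrite !t -!mulmxA; ring.
rewrite !key // -/a -/b -/c.
have e1 : inner (ctr x *m z) c = inner (x *m c) z.
  by rewrite inner_mull ctrKm innerC.
have e2 : inner b (ctr x *m w) = inner (x *m b) w.
  by rewrite innerC inner_mull ctrKm innerC.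
have e3 : inner (w *m a) z = - inner (z *m a) w.
  by rewrite inner_mulr aa mulmxN innerNr innerC.
have e4 : inner (a *m c) b = - inner (a *m b) c.
  by rewrite inner_mull aa mulNmx innerNr innerC.
have e5 : inner (c *m a) b = - inner (b *m a) c.
  by rewrite inner_mulr aa mulmxN innerNr innerC.
rewrite e1 e2 e3 e4 e5; ring.
Qed.

(** Tangency and horizontality of [Z] are both conditions on [ctr Y *m Z Y]; differentiating this
    product gives [dirD_tangent] and [dirD_horizontal]. *)
Lemma is_derive_ctr_mul Z Y x c : smooth_on St Z -> St Y -> curve_at St Y x c ->
  is_derive (0 : R) (1 : R) (fun t => ctr (c t) *m Z (c t) : M d d)
    (ctr x *m Z Y + ctr Y *m dirD St Z Y x : M d d).
Proof.
move=> sZ YY cc; have dZ := dirD_curve sZ YY cc; have [_ c0 dc] := cc.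
have := is_derive_bilinear (mulmx_bilinear F d n d)
  (is_derive_linear (ctr_linear K n d) dc) dZ.
by rewrite /= c0.
Qed.

Lemma dirD_tangent Z Y x : vfield St Z -> St Y -> tangent St Y x ->
  ctr (ctr x *m Z Y + ctr Y *m dirD St Z Y x) =
  - (ctr x *m Z Y + ctr Y *m dirD St Z Y x).
Proof.
move=> [sZ tZ] YY [c cc]; have dm := is_derive_ctr_mul sZ YY cc.
have d1 := is_deriveD (is_derive_linear (ctr_linear K d d) dm) dm.
have cE : (fun t => ctr (ctr (c t) *m Z (c t)) : M d d) +
    (fun t => ctr (c t) *m Z (c t) : M d d) = cst (0 : M d d).
  apply/funext => t; have [Sc _ _] := cc.
  have /(tangent_stiefelP _ (Sc t)) h := tZ _ (Sc t).
  by rewrite -[LHS]/(ctr (ctr (c t) *m Z (c t)) + ctr (c t) *m Z (c t)) h addNr.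
rewrite cE in d1.
have := is_derive_unique d1 (is_derive_cst (0 : M d d) (0 : R) (1 : R)).
by move/eqP; rewrite addr_eq0 => /eqP.
Qed.

Definition hfield X := smooth_on St X /\ forall Y, St Y -> H Y (X Y).

Lemma hfield_vfield X : hfield X -> vfield St X.
Proof. by move=> [sX hX]; split=> // Y /hX /horizontal_tangent. Qed.

Lemma dirD_horizontal Z Y x : hfield Z -> St Y -> tangent St Y x ->
  symf (ctr Y *m dirD St Z Y x) = - symf (ctr x *m Z Y).
Proof.
move=> [sZ hZ] YY [c cc]; have dm := is_derive_ctr_mul sZ YY cc.
have d1 := is_derive_linear (symf_bounded F p) dm.
have cE : (fun t => symf (ctr (c t) *m Z (c t)) : M d d) = cst (0 : M d d).
  apply/funext => t; have [Sc _ _] := cc.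
  exact/(horizontalP alpha0 halpha1 _ (Sc t))/hZ.
rewrite cE in d1.
have := is_derive_unique d1 (is_derive_cst (0 : M d d) (0 : R) (1 : R)).
by rewrite symfD addrC => /eqP; rewrite addr_eq0 => /eqP.
Qed.

(** The last term comes from the dependence of the metric on the base point, and is the right side
    of [christoffel_metric]. *)
Lemma dirD_gmetric Z T Y x : smooth_on St Z -> smooth_on St T -> St Y ->
  tangent St Y x ->
  dirD St (fun y => g y (Z y) (T y)) Y x =
  g Y (dirD St Z Y x) (T Y) + g Y (Z Y) (dirD St T Y x) +
  (alpha1 - alpha0) *
    (inner (ctr x *m Z Y) (ctr Y *m T Y) + inner (ctr Y *m Z Y) (ctr x *m T Y)).
Proof.
move=> sZ sT YY tx; apply: dirD_curvesP tx _ => c cc.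
have [Sc c0 dc] := cc.
have dZ := dirD_curve sZ YY cc; have dT := dirD_curve sT YY cc.
have mZ := is_derive_ctr_mul sZ YY cc; have mT := is_derive_ctr_mul sT YY cc.
have d1 := is_derive_bilinear (inner_bilinear K n d) dZ dT.
have d2 := is_derive_bilinear (inner_bilinear K d d) mZ mT.
have := is_deriveD (is_deriveZ alpha0 d1) (is_deriveZ (alpha1 - alpha0) d2).
have -> : alpha0 *: (fun s => inner ((Z \o c) s) ((T \o c) s)) +
   (alpha1 - alpha0) *:
     (fun s => inner (ctr (c s) *m Z (c s)) (ctr (c s) *m T (c s))) =
   (fun y => g y (Z y) (T y)) \o c.
  by apply/funext => s; rewrite /= gmetricE.
move=> h; apply: is_derive_eq h _.
rewrite !gmetricE /= c0 !inner_linear.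
rewrite -![_ *: _]/(_ * _).
ring.
Qed.


(** [delta] measures the defect of [nabla] from the candidate. Its symmetries are applied with a
    field [T] extending the value [delta X Z], and definiteness of the metric concludes. *)
Lemma levi_civitaE nabla X Z Y : levi_civita St g nabla ->
  vfield St X -> vfield St Z -> St Y ->
  nabla X Z Y = dirD St Z Y (X Y) + christoffel Y (X Y) (Z Y).
Proof.
move=> LC vX vZ YY.
have [delta deltaE] : exists delta : (E -> E) -> (E -> E) -> E, forall V1 V2,
    delta V1 V2 = nabla V1 V2 Y - (dirD St V2 Y (V1 Y) + christoffel Y (V1 Y) (V2 Y)).
  by eexists => V1 V2.
have gdelta V1 V2 w : g Y (delta V1 V2) w =
    g Y (nabla V1 V2 Y) w - (g Y (dirD St V2 Y (V1 Y)) w + g Y (christoffel Y (V1 Y) (V2 Y)) w).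
  by rewrite deltaE gmetricDl gmetricNl gmetricDl.
have tan V1 : vfield St V1 -> tangent St Y (V1 Y) by move=> [_]; apply.
have skew V1 : vfield St V1 -> ctr (ctr Y *m V1 Y) = - (ctr Y *m V1 Y).
  by move=> /tan /(tangent_stiefelP _ YY).
have dsym V1 V2 : vfield St V1 -> vfield St V2 -> delta V1 V2 = delta V2 V1.
  move=> v1 v2; have tf := lc_torsion_free LC v1 v2 YY.
  rewrite !deltaE (christoffelC Y (V1 Y)); apply: inner_inj => z.
  have := congr1 (fun u : E => inner u z) tf; rewrite !inner_linear; lra.
have danti V1 V2 V3 : vfield St V1 -> vfield St V2 -> vfield St V3 ->
    g Y (delta V1 V2) (V3 Y) = - g Y (delta V1 V3) (V2 Y).
  move=> v1 v2 v3; have := lc_metric LC v1 v2 v3 YY.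
  rewrite (dirD_gmetric (proj1 v2) (proj1 v3) YY (tan _ v1)).
  rewrite -(christoffel_metric YY (skew _ v1) (skew _ v2) (skew _ v3)).
  rewrite (gdelta V1 V2) (gdelta V1 V3).
  rewrite (gmetricC alpha0 alpha1 Y (V2 Y) (dirD St V3 Y (V1 Y))).
  rewrite (gmetricC alpha0 alpha1 Y (V2 Y) (christoffel Y (V1 Y) (V3 Y))).
  rewrite (gmetricC alpha0 alpha1 Y (V2 Y) (nabla V1 V3 Y)).
  have aux (d1 d2 c1 c2 n1 n2 : R) : d1 + d2 + (c1 + c2) = n1 + n2 ->
    n1 - (d1 + c1) = - (n2 - (d2 + c2)) by lra.
  exact: aux.
(* Only a tangent value extends to a vector field [T]. The [christoffel] term cancels the symmetric
   part of [ctr Y *m dirD St Z Y (X Y)]. *)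
have dtan : tangent St Y (delta X Z).
  apply/(tangent_stiefelP _ YY).
  have h1 := skew _ (lc_vfield LC vX vZ).
  have h2 := dirD_tangent vZ YY (tan _ vX).
  rewrite deltaE mulmxBr [ctr Y *m (_ + _)]mulmxDr ctr_christoffel //.
  move: (ctr Y *m nabla X Z Y) (ctr Y *m dirD St Z Y (X Y)) h1 h2 => A B h1 h2.
  rewrite ctrB ctrDm ctrZ ctrDm !ctrM !ctrKm h1; apply: inner_inj => z.
  have := congr1 (fun u : 'M_d => inner u z) h2.
  rewrite ctrDm ctrM ctrKm !inner_linear; lra.
have [T vT TE] := tangent_vfield YY dtan.
(* A form symmetric in its first two arguments and antisymmetric in its last
   two vanishes. *)
have dd : g Y (delta X Z) (T Y) = 0.
  have e1 := danti _ _ _ vX vZ vT; have e2 := danti _ _ _ vT vX vZ.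
  have e3 := danti _ _ _ vZ vT vX.
  rewrite (dsym _ _ vX vT) in e1; rewrite (dsym _ _ vT vZ) in e2.
  rewrite (dsym _ _ vZ vX) in e3; lra.
rewrite TE in dd; rewrite -[LHS](subrK (dirD St Z Y (X Y) + christoffel Y (X Y) (Z Y))) -deltaE.
by rewrite (gmetric_eq0 halpha0 halpha1 YY dd) add0r.
Qed.

(** The projection removes the first summand of [christoffel], which [symf] fixes after
    multiplication by [ctr Y]; [dirD_horizontal] produces the [symf] term in its place. *)
Lemma PiH_levi_civita nabla X Z Y : levi_civita St g nabla ->
  hfield X -> hfield Z -> St Y ->
  Pi Y (nabla X Z Y) =
  dirD St Z Y (X Y) + Y *m symf (ctr (X Y) *m Z Y) + second_order Y (X Y) (Z Y).
Proof.
move=> LC hX hZ YY; have vX := hfield_vfield hX; have vZ := hfield_vfield hZ.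
have tX : tangent St Y (X Y) by exact: (proj2 vX).
rewrite (levi_civitaE LC vX vZ YY) PiHE // /PiH_formula.
rewrite [ctr Y *m (_ + _)]mulmxDr symfD (dirD_horizontal hZ YY tX) ctr_christoffel // symfZ.
have -> : symf (ctr (X Y) *m Z Y + ctr (Z Y) *m X Y) =
    ctr (X Y) *m Z Y + ctr (Z Y) *m X Y.
  by apply: symf_sym; rewrite ctrDm !ctrM !ctrKm addrC.
rewrite /christoffel [Y *m (- _ + _)]mulmxDr mulmxN scalemxRr.
by apply: inner_inj => u; rewrite !inner_linear; ring.
Qed.

(** Smoothness is read off the closed formula, since [PiH] and [ginv] are defined by choice. The
    connection axioms can then be applied to the gradient. *)
Lemma smooth_rgrad fY : smooth_on St fY -> smooth_on St (rgrad alpha0 alpha1 fY).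
Proof.
move=> sf.
have sY : smooth_on St (fun Y : E => Y) by exact: smooth_id.
have sYf : smooth_on St (fun Y : E => ctr Y *m fY Y : M d d).
  exact: (smooth_bilinear (mulmx_bilinear F d n d) (smooth_linear (ctr_linear K n d) sY) sf).
have s1 : smooth_on St (fun Y : E => Y *m (ctr Y *m fY Y) : E).
  exact: (smooth_bilinear (mulmx_bilinear F n d d) sY sYf).
have s2 : smooth_on St (fun Y : E => Y *m symf (ctr Y *m fY Y) : E).
  exact: (smooth_bilinear (mulmx_bilinear F n d d) sY (smooth_linear (symf_bounded F p) sYf)).
apply: smooth_ext (smoothD (smoothD (smoothZ alpha0^-1 sf)
  (smoothZ (alpha1^-1 - alpha0^-1) s1)) (smoothZ (- alpha1^-1) s2)) => Y YY.
by rewrite rgradE // mulmxA scaleNr.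
Qed.

Lemma rgrad_hfield fY : smooth_on St fY -> hfield (rgrad alpha0 alpha1 fY).
Proof.
by move=> sf; split; [exact: smooth_rgrad|move=> Y YY; exact: PiH_horizontal].
Qed.

Lemma gmetric_rgrad fY Y v : St Y -> H Y v ->
  g Y v (rgrad alpha0 alpha1 fY Y) = inner v (fY Y).
Proof. by move=> YY hv; rewrite gmetricC gmetric_PiH // gmetricC gmetric_ginv. Qed.

Lemma rgradP f fY Y : ambient_gradient f fY -> St Y ->
  is_rgrad alpha0 alpha1 f Y (rgrad alpha0 alpha1 fY Y).
Proof.
move=> [sf df] YY; split=> [|v hv]; first exact: PiH_horizontal.
have [X vX XE] := tangent_vfield YY (horizontal_tangent hv).
by rewrite gmetric_rgrad // -XE df.
Qed.

End LeviCivita.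

(** * Hessian *)

Section Hessian.
Context {R : realType} (F : ground) (n q : nat) (p : 'I_q.+1 -> nat).
Local Notation K := (scal R F).
Local Notation M := (rmx K).
Local Notation d := (\sum_i p i)%N.
Local Notation E := (M n d).
Local Notation St := (stiefel R F n p).
Context (alpha0 alpha1 : R) (halpha0 : 0 < alpha0) (halpha1 : 0 < alpha1).
Local Notation g := (gmetric alpha0 alpha1).
Local Notation H := (horizontal alpha0 alpha1).
Local Notation Pi := (PiH alpha0 alpha1).
Local Notation second_order := (second_order alpha0 alpha1).
Local Notation hfield := (hfield alpha0 alpha1).
Local Notation beta := ((alpha0 - alpha1) / alpha0).
Implicit Types (Y v w x z u : E) (X Z T : E -> E).

(** The derivative of [inner (fY y) (Z y)] is computed by [lc_metric] and by the product rule; on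
    comparison the terms in [dirD] of [Z] cancel. *)
Lemma rhess02E nabla fY X Z Y : levi_civita St g nabla -> smooth_on St fY ->
  hfield X -> hfield Z -> St Y ->
  rhess02 alpha0 alpha1 nabla fY X Z Y = inner (dirD St fY Y (X Y)) (Z Y)
  - inner (Y *m symf (ctr (X Y) *m Z Y) + second_order Y (X Y) (Z Y)) (fY Y).
Proof.
move=> LC sf hX hZ YY; have vX := hfield_vfield hX; have vZ := hfield_vfield hZ.
have tX : tangent St Y (X Y) by exact: (proj2 vX).
have hG := rgrad_hfield halpha0 halpha1 sf; have vG := hfield_vfield hG.
rewrite /rhess02 /rhess11 gmetric_PiH //; last exact: (proj2 hZ).
have := lc_metric LC vX vG vZ YY.
have -> : dirD St (fun y => g y (rgrad alpha0 alpha1 fY y) (Z y)) Y (X Y) =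
    dirD St (fun y => inner (fY y) (Z y)) Y (X Y).
  apply: dirD_ext => y yy; rewrite gmetricC innerC.
  exact: (gmetric_rgrad halpha0 halpha1 fY yy (proj2 hZ _ yy)).
have -> : dirD St (fun y => inner (fY y) (Z y)) Y (X Y) =
    inner (dirD St fY Y (X Y)) (Z Y) + inner (fY Y) (dirD St Z Y (X Y)).
  apply: dirD_curvesP tX _ => c cc.
  have := is_derive_bilinear (inner_bilinear K n d) (dirD_curve sf YY cc)
    (dirD_curve (proj1 hZ) YY cc).
  by have [_ c0 _] := cc; rewrite /= c0.
rewrite (gmetricC _ _ Y (rgrad _ _ _ _)).
(* The gradient is horizontal, so only the horizontal part of [nabla X Z Y] contributes. *)
have -> : g Y (nabla X Z Y) (rgrad alpha0 alpha1 fY Y) = inner (Pi Y (nabla X Z Y)) (fY Y).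
  rewrite -(gmetric_rgrad halpha0 halpha1 fY YY (PiH_horizontal halpha0 halpha1 _ YY)).
  exact: (esym (gmetric_PiH halpha0 halpha1 _ YY (proj2 hG _ YY))).
rewrite (PiH_levi_civita halpha0 halpha1 LC hX hZ YY) !inner_linear (innerC (fY Y)); lra.
Qed.

Lemma smooth_PiH v : smooth_on St (fun Y => PiH_formula Y v).
Proof.
have sY : smooth_on St (fun Y : E => Y) by exact: smooth_id.
have sYv : smooth_on St (fun Y : E => ctr Y *m v : M d d).
  apply: (smooth_bilinear (mulmx_bilinear F d n d) (smooth_linear (ctr_linear K n d) sY)).
  exact: smooth_cst.
have s2 : smooth_on St (fun Y : E => Y *m symf (ctr Y *m v) : E).
  exact: (smooth_bilinear (mulmx_bilinear F n d d) sY (smooth_linear (symf_bounded F p) sYv)).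
have s1 : smooth_on St (fun _ : E => v) by exact: smooth_cst.
by apply: smooth_ext (smoothD s1 (smoothZ (-1) s2)) => Y _; rewrite scaleN1r.
Qed.

Lemma horizontal_extension Y v : St Y -> H Y v -> exists2 Z, hfield Z & Z Y = v.
Proof.
move=> YY hv; exists (fun Y => PiH_formula Y v).
  by split; [exact: smooth_PiH|move=> Z ZZ; exact: (PiH_formula_horizontal alpha0 halpha1)].
by rewrite /PiH_formula; move/(horizontalP _ halpha1 _ YY): hv => ->; rewrite mulmx0 subr0.
Qed.

(** Isolates [v]: with [N = Pi0 Y *m w *m ctr Y], the two products in [second_order] contribute
    [ctr N] and [N] acting on [x]. *)
Lemma second_order_adj Y x v w :
  inner (second_order Y x v) w =
  inner (beta *: ((Pi0 Y *m w *m ctr Y + Y *m ctr w *m Pi0 Y) *m x : E)) v.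
Proof.
rewrite /second_order !innerZlm; congr (_ * _).
rewrite -mulmxA inner_mull ctr_Pi0 inner_mulr mulmxDl.
set N := Pi0 Y *m w *m ctr Y.
have cN : ctr N = Y *m ctr w *m Pi0 Y by rewrite /N !ctrM ctrKm ctr_Pi0 mulmxA.
rewrite -cN !innerDlm addrC; congr (_ + _).
  by rewrite inner_mulr ctrKm innerC.
by rewrite inner_mull -inner_ctr ctrM !ctrKm innerC.
Qed.

(** Both sides are horizontal, so it suffices to pair them with a horizontal [v]. Extending [v] to a
    field brings in [rhess02E], and adjoints then move everything off [v]. *)
Lemma rhess11E nabla fY X Y : levi_civita St g nabla -> smooth_on St fY ->
  hfield X -> St Y ->
  rhess11 alpha0 alpha1 nabla fY X Y =
  Pi Y (ginv alpha0 alpha1 Y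
    (dirD St fY Y (X Y) - X Y *m symf (ctr Y *m fY Y)
     - beta *: ((Pi0 Y *m fY Y *m ctr Y + Y *m ctr (fY Y) *m Pi0 Y) *m X Y : E))).
Proof.
move=> LC sf hX YY.
apply: (horizontal_inj halpha0 halpha1 YY); [exact: PiH_horizontal|exact: PiH_horizontal|].
move=> v hv; have [Z hZ ZE] := horizontal_extension YY hv.
have := rhess02E LC sf hX hZ YY; rewrite /rhess02 ZE => ->.
rewrite gmetric_PiH // gmetricC gmetric_ginv // innerC innerDlm second_order_adj.
have -> : inner (Y *m symf (ctr (X Y) *m v)) (fY Y) =
    inner (X Y *m symf (ctr Y *m fY Y)) v.
  by rewrite inner_mull symf_adj inner_mull ctrKm innerC.
by rewrite !inner_linear !(innerC v); ring.
Qed.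

End Hessian.

Theorem theorem2 (R : realType) (F : ground) (n q : nat) (p : 'I_q.+1 -> nat)
    (hp : forall i, i != ord_max -> (0 < p i)%N)
    (hdn : (0 < \sum_i p i < n)%N)
    (alpha0 alpha1 : R) (halpha0 : 0 < alpha0) (halpha1 : 0 < alpha1) :
  let K := scal R F in
  let d := (\sum_i p i)%N in
  let E := rmx K n d in
  let St : set E := stiefel R F n p in
  let H : E -> E -> Prop := horizontal alpha0 alpha1 in
  let Pi : E -> E -> E := PiH alpha0 alpha1 in
  (* horizontal space *)
  (forall Y w : E, St Y ->
     (H Y w <-> symf (ctr Y *m w) = 0) /\
     (symf (ctr Y *m w) = 0 <->
      ctr (ctr Y *m w) = - (ctr Y *m w) /\
      forall i, i != ord_max -> submxblock (symf (ctr Y *m w)) i i = 0)) /\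
  (* projection *)
  (forall Y w : E, St Y -> Pi Y w = w - Y *m symf (ctr Y *m w)) /\
  (* Riemannian gradient *)
  (forall (f : E -> R) (fY : E -> E),
     smooth_on St f -> Uinvariant f -> ambient_gradient f fY ->
     forall Y : E, St Y ->
       is_rgrad alpha0 alpha1 f Y (rgrad alpha0 alpha1 fY Y) /\
       rgrad alpha0 alpha1 fY Y =
         alpha0^-1 *: fY Y
         + (alpha1^-1 - alpha0^-1) *: (Y *m ctr Y *m fY Y : E)
         - alpha1^-1 *: (Y *m symf (ctr Y *m fY Y) : E)) /\
  forall nabla : (E -> E) -> (E -> E) -> E -> E,
  levi_civita St (gmetric alpha0 alpha1) nabla ->
  (* Levi-Civita connection *)
  (forall xi eta : E -> E,
     hlift alpha0 alpha1 xi -> hlift alpha0 alpha1 eta ->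
     forall Y : E, St Y ->
       Pi Y (nabla xi eta Y) =
         dirD St eta Y (xi Y) + Y *m symf (ctr (xi Y) *m eta Y)
         + ((alpha0 - alpha1) / alpha0) *:
           (Pi0 Y *m (xi Y *m ctr (eta Y) + eta Y *m ctr (xi Y)) *m Y : E)) /\
  (* Riemannian Hessians *)
  (forall (f : E -> R) (fY : E -> E),
     smooth_on St f -> Uinvariant f -> ambient_gradient f fY ->
     forall xi eta : E -> E,
     hlift alpha0 alpha1 xi -> hlift alpha0 alpha1 eta ->
     forall Y : E, St Y ->
       rhess02 alpha0 alpha1 nabla fY xi eta Y =
         inner (dirD St fY Y (xi Y)) (eta Y)
         - sre K (\tr (ctr (fY Y) *m
             (Y *m symf (ctr (xi Y) *m eta Y)
              + ((alpha0 - alpha1) / alpha0) *: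
                (Pi0 Y *m (xi Y *m ctr (eta Y) + eta Y *m ctr (xi Y)) *m Y
                 : E)))) /\
       rhess11 alpha0 alpha1 nabla fY xi Y =
         Pi Y (ginv alpha0 alpha1 Y
           (dirD St fY Y (xi Y) - xi Y *m symf (ctr Y *m fY Y)
            - ((alpha0 - alpha1) / alpha0) *:
              ((Pi0 Y *m fY Y *m ctr Y + Y *m ctr (fY Y) *m Pi0 Y) *m xi Y
               : E)))).
Proof.
have hliftP X : hlift alpha0 alpha1 X -> @hfield R F n q p alpha0 alpha1 X.
  by case=> sX hX _.
split; [|split; [|split; [|move=> nabla LC; split]]].
- move=> Y w YY; split; first exact: (horizontalP alpha0 halpha1).
  exact: symf_eq0_blocks.
- by move=> Y w YY; rewrite PiHE.
- move=> f fY sf If df Y YY; split; first exact: rgradP.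
  exact: rgradE.
- move=> xi eta /hliftP hxi /hliftP heta Y YY.
  exact: (PiH_levi_civita halpha0 halpha1 LC hxi heta YY).
- move=> f fY sf If [sfY _] xi eta /hliftP hxi /hliftP heta Y YY; split.
    rewrite (rhess02E halpha0 halpha1 LC sfY hxi heta YY).
    (* Cyclicity of the trace turns [inner] with [fY Y] into the trace form of the statement. *)
    by rewrite mxtrace_mulC.
  exact: (rhess11E halpha0 halpha1 LC sfY hxi YY).
Qed.
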